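(* Let $\Lambda_{ABC}$ be an entanglement-redistribution box, i.e. an ES-box, a 2EPR-GHZ box, or a GHZ-EPR box. Then there are unitary operators $U_A^i$ on Alice's qubit, unitary operators $U_B^i$ on Bob's qubit, and operators $E_C^i$ on Charlie's system such that, for every input state $\rho_{ABC}$, $$\Lambda_{ABC}(\rho_{ABC})=\operatorname{Tr}_C\Big(\sum_i (U_A^i\otimes U_B^i\otimes E_C^i)\,\rho_{ABC}\,(U_A^{i}\otimes U_B^{i}\otimes E_C^{i})^\dagger\Big)$$ if the box is an ES-box or a GHZ-EPR box, and the same formula without the partial trace $\operatorname{Tr}_C$ holds if the box is a 2EPR-GHZ box. Moreover the operators $E_C^i$ have the following form, depending on the kind of box. [ES] $E_C^i=|u^i\rangle\langle\psi_+^i|$ are rank-one operators, where the $|\psi_+^i\rangle$ are normalized maximally entangled states of Charlie's two qubits $C_1C_2$, and $\sum_i E_C^{i\dagger}E_C^i=\sum_i\|u^i\|^2|\psi_+^i\rangle\langle\psi_+^i|=\mathbb{1}_{C_1C_2}$. [2EPR-GHZ] $E_C^i=c_i\big(|c_0\rangle\langle a_0^i b_0^i|+|c_1\rangle\langle a_1^i b_1^i|\big)$ are rank-two operators, where $c_i\in\mathbb{C}$, $\langle c_m|c_n\rangle=\delta_{mn}$, $|a_k^ib_k^i\rangle=|a_k^i\rangle_{C_1}|b_k^i\rangle_{C_2}$ with $\langle a_r^i|a_s^i\rangle=\langle b_r^i|b_s^i\rangle=\delta_{rs}$ for all $i$, and $\sum_i|c_i|^2\big(|a_0^ib_0^i\rangle\langle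 a_0^ib_0^i|+|a_1^ib_1^i\rangle\langle a_1^ib_1^i|\big)=\mathbb{1}_C$. [GHZ-EPR] $E_C^i=|u^i\rangle\langle\psi^i|$ are rank-one operators, where $|\psi^i\rangle=\frac{1}{\sqrt2}(|0\rangle+e^{\mathrm{i}\phi_i}|1\rangle)$ with $\phi_i\in\mathbb{R}$, and $\sum_i E_C^{i\dagger}E_C^i=\sum_i\|u^i\|^2|\psi^i\rangle\langle\psi^i|=\mathbb{1}_C$.
   Context: Three parties: Alice ($A$), Bob ($B$), Charlie ($C$). Notation: $|\Psi^+\rangle_{XY}=\frac1{\sqrt2}(|00\rangle+|11\rangle)$ (EPR pair of two qubits), $|GHZ\rangle_{ABC}=\frac1{\sqrt2}(|000\rangle+|111\rangle)$. A tripartite LOCC operation $\Lambda_{ABC}$ is a quantum channel (completely positive trace-preserving map) implemented by Alice, Bob and Charlie by rounds of local quantum operations and classical communication among them, with no pre-shared entanglement. Alice's and Bob's systems are qubits both at input and at output. An LOCC operation is called: - an ES-box (entanglement swapping) if Charlie's input system consists of two qubits $C=C_1C_2$ and the input $|\Psi^+\rangle_{AC_1}|\Psi^+\rangle_{BC_2}$ is mapped to the output $|\Psi^+\rangle_{AB}$; - a 2EPR-GHZ box if Charlie's input system consists of two qubits $C=C_1C_2$ and the input $|\Psi^+\rangle_{AC_1}|\Psi^+\rangle_{BC_2}$ is mapped to the output $|GHZ\rangle_{ABC}$; - a GHZ-EPR box if Charlie's input system is one qubit and the input $|GHZ\rangle_{ABC}$ is mapped to the output $|\Psi^+\rangle_{AB}$.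 For ES- and GHZ-EPR boxes only the $AB$ output is considered: Charlie's output system is traced out. No requirement is made on the action of the box on other inputs. *)

(* Defs.v *)
(* Written in the Mathematical Components world. *)
From HB Require Import structures.
From mathcomp Require Import all_boot all_order all_algebra.
From mathcomp Require Import complex mxtens.
From mathcomp Require Import reals trigo.

Set Implicit Arguments.
Unset Strict Implicit.
Unset Printing Implicit Defensive.

Import Order.TTheory GRing.Theory Num.Theory.
Local Open Scope ring_scope.

(* Kets are column vectors, and a joint system is described by the Kronecker
   product [*t] of mxtens, whose left factor is the most significant one.
   A tripartite system of local dimensions a, b, c lives in dimension
   a * b * c = (a * b) * c, in the order Alice, Bob, Charlie. *)

Reserved Notation "A ^†" (at level 1, left associativity, format "A ^†").

Definition adjmx {C : numClosedFieldType} {m n : nat} (A : 'M[C]_(m, n))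
  : 'M[C]_(n, m) := map_mx Num.conj A^T.
Notation "A ^†" := (adjmx A) : ring_scope.

Definition braket {C : numClosedFieldType} {n : nat} (u v : 'cV[C]_n) : C :=
  (u^† *m v) 0 0.

Definition sqnorm {C : numClosedFieldType} {n : nat} (u : 'cV[C]_n) : C :=
  braket u u.

Definition ketbra {C : numClosedFieldType} {m n : nat}
  (u : 'cV[C]_m) (v : 'cV[C]_n) : 'M[C]_(m, n) := u *m v^†.

Definition proj {C : numClosedFieldType} {n : nat} (u : 'cV[C]_n) : 'M[C]_n :=
  ketbra u u.

Definition tensv {C : numClosedFieldType} {m n : nat}
  (u : 'cV[C]_m) (v : 'cV[C]_n) : 'cV[C]_(m * n) := u *t v.

(* Over a numClosedFieldType, [0 <= z] includes that z is real, so a positive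
   semidefinite matrix is automatically Hermitian. *)
Definition psdmx {C : numClosedFieldType} {n : nat} (A : 'M[C]_n) : Prop :=
  forall v : 'cV[C]_n, 0 <= braket v (A *m v).

Definition density {C : numClosedFieldType} {n : nat} (rho : 'M[C]_n) : Prop :=
  psdmx rho /\ \tr rho = 1.

Definition ptrace1 {C : numClosedFieldType} {m n : nat} (rho : 'M[C]_(m * n))
  : 'M[C]_n :=
  \matrix_(i, j) \sum_k rho (mxtens_index (k, i)) (mxtens_index (k, j)).

Definition ptrace2 {C : numClosedFieldType} {m n : nat} (rho : 'M[C]_(m * n))
  : 'M[C]_m :=
  \matrix_(i, j) \sum_k rho (mxtens_index (i, k)) (mxtens_index (j, k)).

(* The tensor product of two linear maps, obtained by expanding rho on the
   matrix units E_(ij) (x) E_(kl). *)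
Definition tensmap {C : numClosedFieldType} {m m' n n' : nat}
  (f : 'M[C]_m -> 'M[C]_m') (g : 'M[C]_n -> 'M[C]_n') (rho : 'M[C]_(m * n))
  : 'M[C]_(m' * n') :=
  \sum_i \sum_j \sum_k \sum_l
    rho (mxtens_index (i, k)) (mxtens_index (j, l)) *:
      (f (delta_mx i j) *t g (delta_mx k l)).

Definition completely_positive {C : numClosedFieldType} {m m' : nat}
  (f : 'M[C]_m -> 'M[C]_m') : Prop :=
  forall (k : nat) (rho : 'M[C]_(k * m)), psdmx rho -> psdmx (tensmap id f rho).

(* A local quantum operation with a classical outcome x : 'I_k.  The dimension
   d x of the output system may depend on the outcome, so that ancillas can be
   added and subsystems discarded. *)
Definition instrument {C : numClosedFieldType} {m k : nat} {d : 'I_k -> nat}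
  (f : forall x, {linear 'M[C]_m -> 'M[C]_(d x)}) : Prop :=
  (forall x, completely_positive (f x)) /\
  (forall rho, \sum_x \tr (f x rho) = \tr rho).

(* In each round one party applies an instrument to its own system and
   announces the outcome x to the others; the rest of the protocol may depend
   on x.  The numbers a', b', c' are the dimensions of the output systems. *)
Inductive locc {C : numClosedFieldType} (a' b' c' : nat) :
  forall a b c : nat, ('M[C]_(a * b * c) -> 'M[C]_(a' * b' * c')) -> Prop :=
| locc_done (L : 'M[C]_(a' * b' * c') -> 'M[C]_(a' * b' * c')) :
    (forall rho, L rho = rho) -> @locc C a' b' c' a' b' c' L
| locc_Alice (a b c k : nat) (d : 'I_k -> nat)
    (f : forall x, {linear 'M[C]_a -> 'M[C]_(d x)})
    (G : forall x, 'M[C]_(d x * b * c) -> 'M[C]_(a' * b' * c'))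
    (L : 'M[C]_(a * b * c) -> 'M[C]_(a' * b' * c')) :
    instrument f -> (forall x, @locc C a' b' c' (d x) b c (G x)) ->
    (forall rho, L rho = \sum_x G x (tensmap (tensmap (f x) id) id rho)) ->
    @locc C a' b' c' a b c L
| locc_Bob (a b c k : nat) (d : 'I_k -> nat)
    (f : forall x, {linear 'M[C]_b -> 'M[C]_(d x)})
    (G : forall x, 'M[C]_(a * d x * c) -> 'M[C]_(a' * b' * c'))
    (L : 'M[C]_(a * b * c) -> 'M[C]_(a' * b' * c')) :
    instrument f -> (forall x, @locc C a' b' c' a (d x) c (G x)) ->
    (forall rho, L rho = \sum_x G x (tensmap (tensmap id (f x)) id rho)) ->
    @locc C a' b' c' a b c L
| locc_Charlie (a b c k : nat) (d : 'I_k -> nat)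
    (f : forall x, {linear 'M[C]_c -> 'M[C]_(d x)})
    (G : forall x, 'M[C]_(a * b * d x) -> 'M[C]_(a' * b' * c'))
    (L : 'M[C]_(a * b * c) -> 'M[C]_(a' * b' * c')) :
    instrument f -> (forall x, @locc C a' b' c' a b (d x) (G x)) ->
    (forall rho, L rho = \sum_x G x (tensmap id (f x) rho)) ->
    @locc C a' b' c' a b c L.

Definition ket {C : numClosedFieldType} (i : 'I_2) : 'cV[C]_2 := delta_mx i 0.

Definition EPR {C : numClosedFieldType} : 'cV[C]_(2 * 2) :=
  (sqrtC 2)^-1 *: (tensv (ket 0) (ket 0) + tensv (ket 1) (ket 1)).

Definition GHZ {C : numClosedFieldType} : 'cV[C]_(2 * 2 * 2) :=
  (sqrtC 2)^-1 *: (tensv (tensv (ket 0) (ket 0)) (ket 0) +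
                   tensv (tensv (ket 1) (ket 1)) (ket 1)).

(* EPR_{A C1} (x) EPR_{B C2}, with the factors reordered as A, B, (C1, C2). *)
Definition EPR_AC1_BC2 {C : numClosedFieldType} : 'cV[C]_(2 * 2 * (2 * 2)) :=
  \col_x
    let: (ab, c) := mxtens_unindex x in
    let: (a, b) := mxtens_unindex ab in
    let: (c1, c2) := mxtens_unindex c in
    EPR (mxtens_index (a, c1)) 0 * EPR (mxtens_index (b, c2)) 0.

Definition ES_box {C : numClosedFieldType} {c' : nat}
  (L : 'M[C]_(2 * 2 * (2 * 2)) -> 'M[C]_(2 * 2 * c')) : Prop :=
  locc L /\ ptrace2 (L (proj EPR_AC1_BC2)) = proj EPR.

Definition EPR2_GHZ_box {C : numClosedFieldType}
  (L : 'M[C]_(2 * 2 * (2 * 2)) -> 'M[C]_(2 * 2 * 2)) : Prop :=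
  locc L /\ L (proj EPR_AC1_BC2) = proj GHZ.

Definition GHZ_EPR_box {C : numClosedFieldType} {c' : nat}
  (L : 'M[C]_(2 * 2 * 2) -> 'M[C]_(2 * 2 * c')) : Prop :=
  locc L /\ ptrace2 (L (proj GHZ)) = proj EPR.

Definition max_entangled {C : numClosedFieldType} {d : nat}
  (psi : 'cV[C]_(d * d)) : Prop :=
  ptrace1 (proj psi) = (d%:R^-1)%:M /\ ptrace2 (proj psi) = (d%:R^-1)%:M.

Definition kraus_sum {C : numClosedFieldType} {m m' n : nat}
  (K : 'I_n -> 'M[C]_(m', m)) (rho : 'M[C]_m) : 'M[C]_m' :=
  \sum_i K i *m rho *m (K i)^†.

(* e^{i t} *)
Definition cis {R : realType} (t : R) : R[i] := Complex (cos t) (sin t).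

(* Main.v *)
(* An LOCC map is separable: it has product Kraus operators
   K_i = A_i (x) B_i (x) E_i with sum_i K_i^† K_i = 1.  Since the required output
   is pure (on AB, or on ABC), every K_i sends the input vector to a multiple of
   it, hence leaves Alice's and Bob's qubits maximally mixed, with weight p_i.
   For Alice, comparing determinants of reduced states and using the inequality
   of the means bounds p_i by half of tr(A_i^† A_i) times the trace of the state
   produced by B_i and E_i alone.  Both sides sum to 1, so equality holds
   everywhere, and A_i is a multiple of a unitary as soon as p_i <> 0; likewise
   for B_i.  Charlie's input is maximally mixed, so
   p_i <> 0 gives tr(K_i^† K_i) = (4 dim C) p_i; summing over these i already
   exhausts tr 1 = 4 dim C, and therefore p_i = 0 forces K_i = 0.
   With the local unitaries undone, the value of K_i on the input vector
   determines E_i. *)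

Require Import Defs.
From HB Require Import structures.
From mathcomp Require Import all_boot all_order all_algebra.
From mathcomp Require Import complex mxtens.
From mathcomp Require Import boolp reals trigo.
From mathcomp Require Import ring.

Set Implicit Arguments.
Unset Strict Implicit.
Unset Printing Implicit Defensive.

Import Order.TTheory GRing.Theory Num.Theory.
Local Open Scope ring_scope.

(** * Adjoints and Kronecker products *)

Lemma adjmxE {C : numClosedFieldType} m n (A : 'M[C]_(m, n)) i j :
  A^† i j = (A j i)^*.
Proof. by rewrite !mxE. Qed.

Lemma addmxE {C : numClosedFieldType} m n (A B : 'M[C]_(m, n)) i j :
  (A + B) i j = A i j + B i j.
Proof. by rewrite mxE. Qed.

Lemma adjmxK {C : numClosedFieldType} m n (A : 'M[C]_(m, n)) : A^†^† = A.
Proof. by apply/matrixP => i j; rewrite !adjmxE conjCK. Qed.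

Lemma adjmxM {C : numClosedFieldType} m n p (A : 'M[C]_(m, n)) (B : 'M_(n, p)) :
  (A *m B)^† = B^† *m A^†.
Proof. by rewrite /adjmx trmx_mul map_mxM. Qed.

Lemma adjmx1 {C : numClosedFieldType} n : (1%:M : 'M[C]_n)^† = 1%:M.
Proof. by rewrite /adjmx trmx1 map_mx1. Qed.

Lemma adjmxZ {C : numClosedFieldType} m n (c : C) (A : 'M[C]_(m, n)) :
  (c *: A)^† = c^* *: A^†.
Proof. by apply/matrixP => i j; rewrite !mxE rmorphM. Qed.

Lemma adjmxD {C : numClosedFieldType} m n (A B : 'M[C]_(m, n)) :
  (A + B)^† = A^† + B^†.
Proof. by apply/matrixP => i j; rewrite !mxE rmorphD. Qed.

Lemma adjmx_tens {C : numClosedFieldType} m n p q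
  (A : 'M[C]_(m, n)) (B : 'M[C]_(p, q)) : (A *t B)^† = A^† *t B^†.
Proof. by rewrite /adjmx trmx_tens map_mxT. Qed.

Lemma adjmx_delta {C : numClosedFieldType} m n i j :
  (delta_mx i j : 'M[C]_(m, n))^† = delta_mx j i.
Proof. by rewrite /adjmx trmx_delta map_delta_mx. Qed.

Lemma unitarymx_adjP {C : numClosedFieldType} m n {U : 'M[C]_(m, n)} :
  reflect (U *m U^† = 1%:M) (U \is unitarymx).
Proof. exact: unitarymxP. Qed.

Lemma tens11 {C : numClosedFieldType} m n :
  (1%:M : 'M[C]_m) *t (1%:M : 'M[C]_n) = 1%:M.
Proof.
apply/matrixP => i j; case: (mxtens_indexP i) => i0 i1.
case: (mxtens_indexP j) => j0 j1; rewrite tensmxE !mxE.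
rewrite (can_eq (@mxtens_indexK _ _)) xpair_eqE.
by case: (_ == _) (_ == _) => [] []; rewrite /= ?mulr1 ?mulr0 ?mul0r.
Qed.

Lemma sum_mxtens {C : numClosedFieldType} m n (F : 'I_(m * n) -> C) :
  \sum_i F i = \sum_i \sum_j F (mxtens_index (i, j)).
Proof.
rewrite pair_bigA /= (reindex (@mxtens_index m n)) /=; first by apply: eq_bigr => -[].
by exists (@mxtens_unindex m n) => i _; [exact: mxtens_indexK|exact: mxtens_unindexK].
Qed.

(** * Kraus operators of completely positive maps and LOCC *)

Definition kact {C : numClosedFieldType} {m m'} (K : 'M[C]_(m', m))
  (rho : 'M[C]_m) : 'M[C]_m' := K *m rho *m K^†.

Lemma kact_is_linear {C : numClosedFieldType} m m' (K : 'M[C]_(m', m)) :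
  linear (kact K).
Proof. by move=> a x y; rewrite /kact mulmxDr mulmxDl -scalemxAr -scalemxAl. Qed.

HB.instance Definition _ {C : numClosedFieldType} m m' (K : 'M[C]_(m', m)) :=
  GRing.isLinear.Build _ _ _ _ (kact K) (kact_is_linear K).

Lemma kactM {C : numClosedFieldType} m n p (K : 'M[C]_(p, n)) (L : 'M[C]_(n, m))
  rho : kact (K *m L) rho = kact K (kact L rho).
Proof. by rewrite /kact adjmxM !mulmxA. Qed.

Lemma kact1 {C : numClosedFieldType} m (rho : 'M[C]_m) : kact 1%:M rho = rho.
Proof. by rewrite /kact adjmx1 mulmx1 mul1mx. Qed.

Lemma kact_tens {C : numClosedFieldType} m m' n n' (K : 'M[C]_(m', m))
  (L : 'M[C]_(n', n)) rho sigma :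
  kact (K *t L) (rho *t sigma) = kact K rho *t kact L sigma.
Proof. by rewrite /kact adjmx_tens !tensmx_mul. Qed.

Lemma mxtrace_kact {C : numClosedFieldType} m m' (K : 'M[C]_(m', m)) rho :
  \tr (kact K rho) = \tr (K^† *m K *m rho).
Proof. by rewrite /kact mxtrace_mulC mulmxA. Qed.

Lemma kact_proj {C : numClosedFieldType} m m' (K : 'M[C]_(m', m)) v :
  kact K (proj v) = proj (K *m v).
Proof. by rewrite /kact /proj /ketbra adjmxM !mulmxA. Qed.

(** * Inner products and positive semidefinite matrices *)

Lemma braketE {C : numClosedFieldType} n (u v : 'cV[C]_n) :
  braket u v = \sum_i (u i 0)^* * v i 0.
Proof. by rewrite /braket mxE; apply: eq_bigr => i _; rewrite adjmxE. Qed.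

Lemma braketB {C : numClosedFieldType} n (u v w : 'cV[C]_n) :
  braket u (v - w) = braket u v - braket u w.
Proof. by rewrite /braket mulmxBr addmxE; congr (_ + _); rewrite mxE. Qed.

Lemma sqnorm_ge0 {C : numClosedFieldType} n (u : 'cV[C]_n) : 0 <= sqnorm u.
Proof. by rewrite /sqnorm braketE sumr_ge0// => i _; rewrite mulrC mul_conjC_ge0. Qed.

Lemma sqnorm_eq0 {C : numClosedFieldType} n (u : 'cV[C]_n) :
  (sqnorm u == 0) = (u == 0).
Proof.
apply/idP/eqP => [|->]; last by rewrite /sqnorm /braket mulmx0 mxE.
rewrite /sqnorm braketE psumr_eq0 => [|i _]; last by rewrite mulrC mul_conjC_ge0.
move=> /allP H; apply/matrixP => i j; rewrite (ord1 j) mxE.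
by apply/eqP; have := H i (mem_index_enum _); rewrite mulrC mul_conjC_eq0.
Qed.

Lemma mxtrace_proj {C : numClosedFieldType} n (u : 'cV[C]_n) :
  \tr (proj u) = sqnorm u.
Proof. by rewrite /proj /ketbra mxtrace_mulC trace_mx11. Qed.

Lemma braket_delta {C : numClosedFieldType} m n (A : 'M[C]_(m, n)) i j :
  braket (delta_mx i 0) (A *m delta_mx j 0) = A i j.
Proof.
rewrite braketE (bigD1 i)//= big1 => [|k /negbTE neq]; last first.
  by rewrite mxE neq conjC0 mul0r.
by rewrite mxE !eqxx conjC1 mul1r addr0 -colE mxE.
Qed.

(** Complex polarization: the vectors [u + v] and [u + 'i v] give the sum and the difference of
    [B u v] and [B v u], so both vanish. *)
Lemma quadratic_form_eq0 {C : numClosedFieldType} n (H : 'M[C]_n) :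
  (forall v, braket v (H *m v) = 0) -> H = 0.
Proof.
move=> H0; pose B u v := braket u (H *m v).
have BD u1 u2 v1 v2 : B (u1 + u2) (v1 + v2) = B u1 v1 + B u1 v2 + (B u2 v1 + B u2 v2).
  by rewrite /B /braket adjmxD mulmxDr mulmxDl !mulmxDr !addmxE.
have BZ a b u v : B (a *: u) (b *: v) = a^* * b * B u v.
  by rewrite /B /braket adjmxZ -scalemxAr -scalemxAl -scalemxAr scalerA mxE.
have anti u v : B u v + B v u = 0.
  by have := BD u v u v; rewrite [B u u]H0 [B v v]H0 [B (u + v) _]H0 add0r addr0.
have B0 u v : B u v = 0.
  have := anti u ('i *: v).
  have := BZ 1 'i u v; have := BZ 'i 1 v u; rewrite !scale1r => -> ->.
  rewrite conjC1 conjCi mul1r mulr1 mulNr -mulrBr => /eqP.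
  rewrite mulf_eq0 (negPf (neq0Ci _)) /= => /eqP BB.
  have : B u v *+ 2 = (B u v + B v u) + (B u v - B v u) by rewrite addrACA subrr addr0.
  by rewrite anti BB addr0 => /eqP; rewrite mulrn_eq0 => /eqP.
by apply/matrixP => i j; rewrite -braket_delta [LHS]B0 mxE.
Qed.

Lemma psdmx_hermitian {C : numClosedFieldType} n (A : 'M[C]_n) :
  psdmx A -> A^† = A.
Proof.
move=> psdA; apply/eqP; rewrite -subr_eq0; apply/eqP/quadratic_form_eq0 => v.
have adjA : braket v (A^† *m v) = (braket v (A *m v))^*.
  by rewrite /braket -adjmxE !adjmxM adjmxK mulmxA.
by rewrite mulmxBl braketB adjA (CrealP (ger0_real (psdA v))) subrr.
Qed.

(** Spectral theorem: the vectors are the eigenvectors scaled by the square roots of their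
    eigenvalues. *)
Lemma psdmx_sum_proj {C : numClosedFieldType} n (A : 'M[C]_n) :
  psdmx A -> exists v : 'I_n -> 'cV[C]_n, A = \sum_i proj (v i).
Proof.
move=> psdA; have hermA := psdmx_hermitian psdA.
have /orthomx_spectralP : A \is normalmx.
  by apply/normalmxP; rewrite -/(adjmx A) hermA.
have := spectral_unitarymx A; set P := spectralmx A; set d := spectral_diag A.
move=> PU; rewrite invmx_unitary// -/(adjmx P) => defA.
have PP : P *m P^† = 1%:M by apply/unitarymx_adjP.
have d_ge0 i : 0 <= d 0 i.
  have := psdA (P^† *m delta_mx i 0); rewrite /braket adjmxM adjmxK defA.
  rewrite -!mulmxA (mulmxA P P^†) PP mul1mx (mulmxA P P^†) PP mul1mx.
  by rewrite -/(braket _ _) braket_delta mxE eqxx mulr1n.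
exists (fun i => sqrtC (d 0 i) *: (P^† *m delta_mx i 0)).
rewrite {1}defA diag_mx_sum_delta mulmx_sumr mulmx_suml; apply: eq_bigr => i _.
rewrite /proj /ketbra adjmxZ adjmxM adjmxK -scalemxAl -!scalemxAr scalerA -scalemxAl.
have -> : sqrtC (d 0 i) * (sqrtC (d 0 i))^* = d 0 i.
  by rewrite (CrealP (ger0_real _)) ?sqrtC_ge0// -expr2 sqrtCK.
congr (_ *: _); rewrite !mulmxA; congr (_ *m _); rewrite -!mulmxA; congr (_ *m _).
by rewrite adjmx_delta mul_delta_mx.
Qed.

(** * Kraus families and complete positivity *)

Definition ksum {C : numClosedFieldType} {m m'} (s : seq 'M[C]_(m', m))
  (rho : 'M[C]_m) : 'M[C]_m' := \sum_(K <- s) kact K rho.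

Lemma ksum_is_linear {C : numClosedFieldType} m m' (s : seq 'M[C]_(m', m)) :
  linear (ksum s).
Proof.
move=> a x y; rewrite /ksum scaler_sumr -big_split.
by apply: eq_bigr => K _; rewrite linearP.
Qed.

HB.instance Definition _ {C : numClosedFieldType} m m' (s : seq 'M[C]_(m', m)) :=
  GRing.isLinear.Build _ _ _ _ (ksum s) (ksum_is_linear s).

(** The left side of the completeness relation: the Kraus family preserves the trace when it equals
    the identity. *)
Definition gram {C : numClosedFieldType} {m m'} (s : seq 'M[C]_(m', m)) : 'M[C]_m :=
  \sum_(K <- s) K^† *m K.

Lemma mxtrace_ksum {C : numClosedFieldType} m m' (s : seq 'M[C]_(m', m)) rho :
  \tr (ksum s rho) = \tr (gram s *m rho).
Proof.
rewrite /gram mulmx_suml !raddf_sum /=.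
by apply: eq_bigr => K _; rewrite mxtrace_kact.
Qed.

Lemma mxtrace_mul_inj {C : numClosedFieldType} n (A B : 'M[C]_n) :
  (forall rho, \tr (A *m rho) = \tr (B *m rho)) -> A = B.
Proof.
move=> AB; apply/matrixP => i j.
have E (D : 'M[C]_n) : \tr (D *m delta_mx j i) = D i j.
  rewrite -(mul_delta_mx (0 : 'I_1)) mulmxA mxtrace_mulC mulmxA trace_mx11.
  by rewrite -colE -rowE !mxE.
by rewrite -E AB E.
Qed.

Lemma tens_sumE {C : numClosedFieldType} m n p
  (F : 'I_m -> 'I_n -> 'M[C]_p) i j k l :
  (\sum_i' \sum_j' delta_mx i' j' *t F i' j')
    (mxtens_index (i, k)) (mxtens_index (j, l)) = F i j k l.
Proof.
rewrite summxE (bigD1 i) //= [X in _ + X]big1 => [|i' /negbTE neq]; last first.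
  by rewrite summxE big1// => j' _; rewrite tensmxE mxE eq_sym neq mul0r.
rewrite summxE (bigD1 j) //= big1 => [|j' /negbTE neq]; last first.
  by rewrite tensmxE mxE [j == j']eq_sym neq andbF mul0r.
by rewrite tensmxE mxE !eqxx mul1r !addr0.
Qed.

(** The block decomposition. Writing every matrix as a sum of products, it reduces identities
    between linear maps to product arguments. *)
Lemma tens_sum_delta {C : numClosedFieldType} m n (rho : 'M[C]_(m * n)) :
  rho = \sum_i \sum_j
    delta_mx i j *t (\matrix_(k, l) rho (mxtens_index (i, k)) (mxtens_index (j, l))).
Proof.
apply/matrixP => x y.
case: (mxtens_indexP x) => i k; case: (mxtens_indexP y) => j l.
by rewrite tens_sumE mxE.
Qed.

Lemma tensmx_suml {C : numClosedFieldType} m n p q (I : Type) (r : seq I)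
  (F : I -> 'M[C]_(m, n)) (B : 'M[C]_(p, q)) :
  (\sum_(i <- r) F i) *t B = \sum_(i <- r) F i *t B.
Proof.
apply/matrixP => i j; rewrite mxE !summxE mulr_suml.
by apply: eq_bigr => k _; rewrite mxE.
Qed.

Lemma tensmx_sumr {C : numClosedFieldType} m n p q (I : Type) (r : seq I)
  (A : 'M[C]_(m, n)) (F : I -> 'M[C]_(p, q)) :
  A *t (\sum_(i <- r) F i) = \sum_(i <- r) A *t F i.
Proof.
apply/matrixP => i j; rewrite mxE !summxE mulr_sumr.
by apply: eq_bigr => k _; rewrite mxE.
Qed.

Lemma tensmxZl {C : numClosedFieldType} m n p q (c : C) (A : 'M[C]_(m, n))
  (B : 'M[C]_(p, q)) : (c *: A) *t B = c *: (A *t B).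
Proof. by apply/matrixP => i j; rewrite !mxE mulrA. Qed.

Lemma tensmxZr {C : numClosedFieldType} m n p q (c : C) (A : 'M[C]_(m, n))
  (B : 'M[C]_(p, q)) : A *t (c *: B) = c *: (A *t B).
Proof. by apply/matrixP => i j; rewrite !mxE mulrCA. Qed.

(* The Choi matrix of f is the image under [id (x) f] of the projector on the
   unnormalised vector sum_i e_i (x) e_i; each term of its spectral
   decomposition, reshaped into a matrix, is a Kraus operator. *)
Lemma completely_positive_ksum {C : numClosedFieldType} m m'
  (f : {linear 'M[C]_m -> 'M[C]_m'}) :
  completely_positive f -> exists s : seq 'M[C]_(m', m), forall rho, f rho = ksum s rho.
Proof.
move=> cpf; pose w : 'cV[C]_(m * m) := \col_x ((mxtens_unindex x).1 == (mxtens_unindex x).2)%:R.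
have psdw : psdmx (proj w).
  move=> v; rewrite /proj /ketbra /braket -mulmxA mulmxA.
  have -> : v^† *m w = (w^† *m v)^† by rewrite adjmxM adjmxK.
  by rewrite mxE big_ord1 adjmxE mulrC mul_conjC_ge0.
have [v Ev] := psdmx_sum_proj (cpf _ _ psdw).
have wE i k : w (mxtens_index (i, k)) 0 = (i == k)%:R by rewrite mxE mxtens_indexK.
(* The block of the Choi matrix at [(i, j)] is the image of the matrix unit at [(i, j)], because [w]
   is supported on equal indices. *)
have choi i j p q : tensmap id f (proj w) (mxtens_index (i, p)) (mxtens_index (j, q))
    = f (delta_mx i j) p q.
  rewrite -(tens_sumE (fun i j => f (delta_mx i j))).
  congr (fun_of_matrix _ _ _); rewrite /tensmap.
  apply: eq_bigr => i' _; apply: eq_bigr => j' _.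
  rewrite (bigD1 i')//= [X in _ + X]big1 => [|k /negbTE neq]; last first.
    by rewrite big1// => l _; rewrite mxE big_ord1 adjmxE wE eq_sym neq mul0r scale0r.
  rewrite (bigD1 j')//= big1 => [|k /negbTE neq]; last first.
    by rewrite mxE big_ord1 adjmxE !wE [j' == k]eq_sym neq conjC0 mulr0 scale0r.
  by rewrite mxE big_ord1 adjmxE !wE !eqxx conjC1 mulr1 scale1r !addr0.
exists [seq \matrix_(p, i) v x (mxtens_index (i, p)) 0 | x <- enum 'I_(m * m')] => rho.
rewrite [rho]matrix_sum_delta !linear_sum; apply: eq_bigr => i _.
rewrite !linear_sum; apply: eq_bigr => j _; rewrite !linearZ; congr (_ *: _).
apply/matrixP => p q; rewrite -choi Ev /= /ksum big_map big_enum /= !summxE.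
apply: eq_bigr => x _; rewrite mxE big_ord1 adjmxE.
rewrite /kact -(mul_delta_mx (0 : 'I_1)) mulmxA -colE -mulmxA -rowE.
by rewrite mxE big_ord1 !mxE.
Qed.

(** Both sides are linear and agree on products, and [tensmap] is by definition the expansion on
    products of matrix units. *)
Lemma tensmap_ksum {C : numClosedFieldType} m m' n n'
  (f : 'M[C]_m -> 'M[C]_m') (g : 'M[C]_n -> 'M[C]_n') s t :
  (forall rho, f rho = ksum s rho) -> (forall rho, g rho = ksum t rho) ->
  forall rho, tensmap f g rho = ksum [seq K *t L | K <- s, L <- t] rho.
Proof.
move=> fE gE rho; pose h : {linear _ -> _} := ksum [seq K *t L | K <- s, L <- t].
rewrite -[ksum _ rho]/(h rho).
have hE X Y : h (X *t Y) = f X *t g Y.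
  rewrite fE gE /h /= /ksum big_allpairs_dep tensmx_suml; apply: eq_bigr => K _.
  by rewrite tensmx_sumr; apply: eq_bigr => L _; rewrite kact_tens.
rewrite {2}[rho]tens_sum_delta.
rewrite linear_sum; apply: eq_bigr => i _; rewrite linear_sum; apply: eq_bigr => j _.
rewrite [\matrix_(k, l) _]matrix_sum_delta tensmx_sumr linear_sum.
apply: eq_bigr => k _; rewrite tensmx_sumr linear_sum; apply: eq_bigr => l _.
by rewrite tensmxZr linearZ mxE -hE.
Qed.

Lemma id_ksum {C : numClosedFieldType} m (rho : 'M[C]_m) :
  id rho = ksum [:: 1%:M] rho.
Proof. by rewrite /ksum big_seq1 kact1. Qed.

(** * LOCC maps are separable *)

Definition tens3 {C : numClosedFieldType} {a b c a' b' c'}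
  (t : 'M[C]_(a', a) * 'M[C]_(b', b) * 'M[C]_(c', c)) :
  'M[C]_(a' * b' * c', a * b * c) := t.1.1 *t t.1.2 *t t.2.

Definition separable_op {C : numClosedFieldType} {a b c a' b' c'}
  (L : 'M[C]_(a * b * c) -> 'M[C]_(a' * b' * c'))
  (s : seq ('M[C]_(a', a) * 'M[C]_(b', b) * 'M[C]_(c', c))) : Prop :=
  (forall rho, L rho = ksum (map tens3 s) rho) /\ gram (map tens3 s) = 1%:M.

(** Complete positivity gives each outcome its own Kraus family. Completeness holds only for all
    outcomes together: it is trace preservation tested against every [rho]. *)
Lemma instrument_ksum {C : numClosedFieldType} m k (d : 'I_k -> nat)
  (f : forall x, {linear 'M[C]_m -> 'M[C]_(d x)}) : instrument f ->
  exists s : forall x, seq 'M[C]_(d x, m),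
    (forall x rho, f x rho = ksum (s x) rho) /\ \sum_x gram (s x) = 1%:M.
Proof.
move=> [cpf tpf]; exists (fun x => sval (cid (completely_positive_ksum (cpf x)))).
split=> [x rho|]; first by case: cid.
apply: mxtrace_mul_inj => rho; rewrite mul1mx -[RHS]tpf mulmx_suml raddf_sum.
by apply: eq_bigr => x _; case: cid => s /= sE; rewrite sE mxtrace_ksum.
Qed.

(** Products of product operators are again product operators, so a round followed by separable
    continuations is separable. All three dimensions may depend on the outcome, so that one
    statement serves whichever party acts. *)
Lemma separable_op_round {C : numClosedFieldType} a b c a' b' c' k
  (da db dc : 'I_k -> nat)
  (T : forall x, seq ('M[C]_(da x, a) * 'M[C]_(db x, b) * 'M[C]_(dc x, c)))
  (G : forall x, 'M[C]_(da x * db x * dc x) -> 'M[C]_(a' * b' * c'))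
  (L : 'M[C]_(a * b * c) -> 'M[C]_(a' * b' * c')) :
  \sum_x gram (map tens3 (T x)) = 1%:M ->
  (forall x, exists s, separable_op (G x) s) ->
  (forall rho, L rho = \sum_x G x (ksum (map tens3 (T x)) rho)) ->
  exists s, separable_op L s.
Proof.
move=> complT sepG LE.
have [s sepS] : {s | forall x, separable_op (G x) (s x)}.
  by exists (fun x => sval (cid (sepG x))) => x; case: cid.
pose mul3 x (t : 'M[C]_(a', da x) * 'M[C]_(b', db x) * 'M[C]_(c', dc x))
  (u : 'M[C]_(da x, a) * 'M[C]_(db x, b) * 'M[C]_(dc x, c)) :=
  (t.1.1 *m u.1.1, t.1.2 *m u.1.2, t.2 *m u.2).
have mul3E x t u : tens3 (mul3 x t u) = tens3 t *m tens3 u.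
  by rewrite /tens3 !tensmx_mul.
exists (flatten [seq [seq mul3 x t u | t <- s x, u <- T x] | x <- enum 'I_k]).
split=> [rho|].
  rewrite LE /ksum big_map big_flatten big_map big_enum; apply: eq_bigr => x _.
  rewrite (sepS x).1 big_allpairs_dep /ksum big_map; apply: eq_bigr => t _.
  rewrite linear_sum big_map; apply: eq_bigr => u _.
  by rewrite mul3E kactM.
rewrite -complT /gram big_map big_flatten big_map big_enum; apply: eq_bigr => x _.
rewrite big_allpairs_dep exchange_big big_map; apply: eq_bigr => u _ /=.
(* The completeness relation of the continuation is inserted between the operator of the round and
   its adjoint. *)
rewrite -[X in _ *m X](mul1mx (tens3 u)) -(sepS x).2 /gram mulmx_suml mulmx_sumr big_map.
by apply: eq_bigr => t _; rewrite mul3E adjmxM !mulmxA.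
Qed.

(** By induction on the protocol: the Kraus operators of the acting party are padded with identities
    for the other two. *)
Lemma locc_separable {C : numClosedFieldType} a b c a' b' c'
  (L : 'M[C]_(a * b * c) -> 'M[C]_(a' * b' * c')) :
  locc L -> exists s, separable_op L s.
Proof.
elim=> {a b c L} [L LE|a b c k d f G L instr _ IH LE|a b c k d f G L instr _ IH LE
  |a b c k d f G L instr _ IH LE].
- exists [:: (1%:M, 1%:M, 1%:M)]; split=> [rho|] /=.
    by rewrite LE /tens3 /= !tens11 -id_ksum.
  by rewrite /gram big_seq1 /tens3 !tens11 adjmx1 mulmx1.
- have [s [fE complS]] := instrument_ksum instr.
  apply: (separable_op_round (T := fun x => [seq (K, 1%:M, 1%:M) | K <- s x])) IH _.
    have /(congr1 (fun M => M *t (1%:M : 'M_b) *t (1%:M : 'M_c))) /= := complS.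
    rewrite !tens11 => <-; rewrite !tensmx_suml; apply: eq_bigr => x _.
    rewrite /gram !big_map !tensmx_suml; apply: eq_bigr => K _.
    by rewrite /tens3 !adjmx_tens !tensmx_mul !adjmx1 !mulmx1.
  move=> rho; rewrite LE; apply: eq_bigr => x _; congr (G x _).
  rewrite (tensmap_ksum (tensmap_ksum (fE x) (@id_ksum _ _)) (@id_ksum _ _)) /ksum.
  by rewrite !(big_allpairs_dep, big_map); apply: eq_bigr => K _; rewrite !big_seq1.
- have [s [fE complS]] := instrument_ksum instr.
  apply: (separable_op_round (T := fun x => [seq (1%:M, K, 1%:M) | K <- s x])) IH _.
    have /(congr1 (fun M => (1%:M : 'M_a) *t M *t (1%:M : 'M_c))) /= := complS.
    rewrite !tens11 => <-; rewrite tensmx_sumr tensmx_suml; apply: eq_bigr => x _.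
    rewrite /gram !big_map tensmx_sumr !tensmx_suml; apply: eq_bigr => K _.
    by rewrite /tens3 !adjmx_tens !tensmx_mul !adjmx1 !mulmx1.
  move=> rho; rewrite LE; apply: eq_bigr => x _; congr (G x _).
  rewrite (tensmap_ksum (tensmap_ksum (@id_ksum _ _) (fE x)) (@id_ksum _ _)) /ksum.
  by rewrite !(big_allpairs_dep, big_map, big_seq1); apply: eq_bigr => K _; rewrite !big_seq1.
- have [s [fE complS]] := instrument_ksum instr.
  apply: (separable_op_round (T := fun x => [seq (1%:M, 1%:M, K) | K <- s x])) IH _.
    have /(congr1 (fun M => (1%:M : 'M_a) *t (1%:M : 'M_b) *t M)) /= := complS.
    rewrite !tens11 => <-; rewrite tensmx_sumr; apply: eq_bigr => x _.
    rewrite /gram !big_map tensmx_sumr; apply: eq_bigr => K _.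
    by rewrite /tens3 !adjmx_tens !tensmx_mul !adjmx1 !mulmx1 tens11.
  move=> rho; rewrite LE; apply: eq_bigr => x _; congr (G x _).
  rewrite (tensmap_ksum (@id_ksum _ _) (fE x)) /ksum.
  by rewrite !(big_allpairs_dep, big_map, big_seq1); apply: eq_bigr => K _; rewrite /tens3 tens11.
Qed.

(** * Partial traces and weights of separable operations *)

(** Every matrix is a sum of products, with the scalars absorbed into one factor, so additive maps
    are determined by product matrices. *)
Lemma tens_additive_ext {C : numClosedFieldType} m n (V : zmodType)
  (f g : {additive 'M[C]_(m * n) -> V}) :
  (forall X Y, f (X *t Y) = g (X *t Y)) -> forall rho, f rho = g rho.
Proof.
move=> fg rho.
rewrite [rho]tens_sum_delta.
rewrite !raddf_sum; apply: eq_bigr => i _; rewrite !raddf_sum.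
by apply: eq_bigr => j _.
Qed.

Lemma tens3_additive_ext {C : numClosedFieldType} m n p (V : zmodType)
  (f g : {additive 'M[C]_(m * n * p) -> V}) :
  (forall X Y Z, f (X *t Y *t Z) = g (X *t Y *t Z)) -> forall rho, f rho = g rho.
Proof.
move=> fg rho; rewrite [rho]tens_sum_delta.
rewrite !raddf_sum; apply: eq_bigr => x _; rewrite !raddf_sum.
apply: eq_bigr => y _.
case: (mxtens_indexP x) => i k; case: (mxtens_indexP y) => j l.
suff -> : delta_mx (mxtens_index (i, k)) (mxtens_index (j, l)) =
    delta_mx i j *t delta_mx k l :> 'M[C]_(m * n) by [].
apply/matrixP => x' y'.
case: (mxtens_indexP x') => i' k'; case: (mxtens_indexP y') => j' l'.
rewrite tensmxE !mxE !(can_eq (@mxtens_indexK _ _)) !xpair_eqE.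
by do 4 case: (_ == _); rewrite /= ?mulr1 ?mulr0 ?mul0r.
Qed.

Lemma ptrace1_is_linear {C : numClosedFieldType} m n :
  linear (@ptrace1 C m n).
Proof.
move=> a x y; apply/matrixP => i j; rewrite !mxE mulr_sumr -big_split.
by apply: eq_bigr => k _; rewrite !mxE.
Qed.

HB.instance Definition _ {C : numClosedFieldType} m n :=
  GRing.isLinear.Build _ _ _ _ (@ptrace1 C m n) (@ptrace1_is_linear C m n).

Lemma ptrace2_is_linear {C : numClosedFieldType} m n :
  linear (@ptrace2 C m n).
Proof.
move=> a x y; apply/matrixP => i j; rewrite !mxE mulr_sumr -big_split.
by apply: eq_bigr => k _; rewrite !mxE.
Qed.

HB.instance Definition _ {C : numClosedFieldType} m n :=
  GRing.isLinear.Build _ _ _ _ (@ptrace2 C m n) (@ptrace2_is_linear C m n).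

Lemma ptrace1_tens {C : numClosedFieldType} m n (X : 'M[C]_m) (Y : 'M[C]_n) :
  ptrace1 (X *t Y) = \tr X *: Y.
Proof.
apply/matrixP => i j; rewrite !mxE /mxtrace mulr_suml.
by apply: eq_bigr => k _; rewrite tensmxE.
Qed.

Lemma ptrace2_tens {C : numClosedFieldType} m n (X : 'M[C]_m) (Y : 'M[C]_n) :
  ptrace2 (X *t Y) = \tr Y *: X.
Proof.
apply/matrixP => i j; rewrite !mxE /mxtrace mulr_suml.
by apply: eq_bigr => k _; rewrite tensmxE mulrC.
Qed.

Lemma mxtrace_tens {C : numClosedFieldType} m n (X : 'M[C]_m) (Y : 'M[C]_n) :
  \tr (X *t Y) = \tr X * \tr Y.
Proof.
rewrite /mxtrace sum_mxtens mulr_suml; apply: eq_bigr => i _.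
by rewrite mulr_sumr; apply: eq_bigr => j _; rewrite tensmxE.
Qed.

Lemma mxtrace_ptrace1 {C : numClosedFieldType} m n (rho : 'M[C]_(m * n)) :
  \tr (ptrace1 rho) = \tr rho.
Proof.
apply: (tens_additive_ext (f := mxtrace \o ptrace1) (g := mxtrace)) => X Y /=.
by rewrite ptrace1_tens mxtrace_tens linearZ.
Qed.

Lemma mxtrace_ptrace2 {C : numClosedFieldType} m n (rho : 'M[C]_(m * n)) :
  \tr (ptrace2 rho) = \tr rho.
Proof.
apply: (tens_additive_ext (f := mxtrace \o ptrace2) (g := mxtrace)) => X Y /=.
by rewrite ptrace2_tens mxtrace_tens linearZ mulrC.
Qed.

(** An operation on the factor that is kept commutes with tracing out the other one. *)
Lemma ptrace2_kact {C : numClosedFieldType} m m' n n' (F : 'M[C]_(m', m))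
  (G : 'M[C]_(n', n)) rho :
  ptrace2 (kact (F *t G) rho) = kact F (ptrace2 (kact (1%:M *t G) rho)).
Proof.
apply: (tens_additive_ext (f := ptrace2 \o kact (F *t G))
  (g := kact F \o ptrace2 \o kact (1%:M *t G))) => X Y /=.
by rewrite !kact_tens !ptrace2_tens kact1 linearZ.
Qed.

Lemma ptrace1_kact {C : numClosedFieldType} m m' n n' (F : 'M[C]_(m', m))
  (G : 'M[C]_(n', n)) rho :
  ptrace1 (kact (F *t G) rho) = kact G (ptrace1 (kact (F *t 1%:M) rho)).
Proof.
apply: (tens_additive_ext (f := ptrace1 \o kact (F *t G))
  (g := kact G \o ptrace1 \o kact (F *t 1%:M))) => X Y /=.
by rewrite !kact_tens !ptrace1_tens kact1 linearZ.
Qed.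

Lemma mxtrace_kact_scalar {C : numClosedFieldType} m m' (F : 'M[C]_(m', m)) a rho :
  F^† *m F = a%:M -> \tr (kact F rho) = a * \tr rho.
Proof. by move=> FF; rewrite mxtrace_kact FF mul_scalar_mx linearZ. Qed.

(** A multiple of an isometry on the factor traced out is seen only through the scalar [a]. *)
Lemma ptrace2_kact_scalar {C : numClosedFieldType} m m' n n' (F : 'M[C]_(m', m))
  (G : 'M[C]_(n', n)) a rho : G^† *m G = a%:M ->
  ptrace2 (kact (F *t G) rho) = a *: kact F (ptrace2 rho).
Proof.
move=> GG; apply: (tens_additive_ext (f := ptrace2 \o kact (F *t G))
  (g := a \*: (kact F \o ptrace2))) => X Y /=.
by rewrite kact_tens !ptrace2_tens (mxtrace_kact_scalar _ GG) linearZ scalerA.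
Qed.

Lemma ptrace1_kact_scalar {C : numClosedFieldType} m m' n n' (F : 'M[C]_(m', m))
  (G : 'M[C]_(n', n)) a rho : F^† *m F = a%:M ->
  ptrace1 (kact (F *t G) rho) = a *: kact G (ptrace1 rho).
Proof.
move=> FF; apply: (tens_additive_ext (f := ptrace1 \o kact (F *t G))
  (g := a \*: (kact G \o ptrace1))) => X Y /=.
by rewrite kact_tens !ptrace1_tens (mxtrace_kact_scalar _ FF) linearZ scalerA.
Qed.

(** Up to normalization this is the completely depolarizing channel, with the matrix units as Kraus
    operators. *)
Lemma sum_kact_delta {C : numClosedFieldType} n (X : 'M[C]_n) :
  \sum_i \sum_j kact (delta_mx i j : 'M_n) X = (\tr X)%:M.
Proof.
have kactE i j : kact (delta_mx i j : 'M_n) X = X j j *: delta_mx i i.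
  have D k l : delta_mx k l = delta_mx k 0 *m (delta_mx 0 l : 'rV_n) :> 'M[C]_n.
    by rewrite mul_delta_mx.
  rewrite /kact adjmx_delta (D i j) (D j i) !mulmxA -(mulmxA _ _ X) -rowE.
  rewrite -(mulmxA _ (row j X)) -colE [col j _]mx11_scalar !mxE mul_mx_scalar.
  by rewrite -scalemxAl mul_delta_mx.
under eq_bigr do rewrite (eq_bigr _ (fun j _ => kactE _ j)) -scaler_suml.
by rewrite -scaler_sumr -mx1_sum_delta scalemx1.
Qed.

(* Replacing Alice's (or Bob's) reduced state by the identity makes the traces
   of the local operators visible as output weights. *)
Lemma sum_weights_Alice {C : numClosedFieldType} a b c n a' b' c'
  (A : 'I_n -> 'M[C]_(a', a)) (B : 'I_n -> 'M[C]_(b', b)) (E : 'I_n -> 'M[C]_(c', c)) rho :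
  \sum_i (A i *t B i *t E i)^† *m (A i *t B i *t E i) = 1%:M ->
  \sum_i \tr ((A i)^† *m A i) * \tr (kact ((1%:M : 'M_a) *t B i *t E i) rho)
    = a%:R * \tr rho.
Proof.
move=> complK.
pose twirl : {linear 'M[C]_(a * b * c) -> 'M[C]_(a * b * c)} :=
  ksum [seq delta_mx i j *t 1%:M *t 1%:M | i <- index_enum 'I_a, j <- index_enum 'I_a].
have twirlE X Y Z : twirl (X *t Y *t Z) = (\tr X)%:M *t Y *t Z.
  rewrite /twirl /= /ksum big_allpairs_dep -sum_kact_delta !tensmx_suml.
  apply: eq_bigr => i _; rewrite !tensmx_suml.
  by apply: eq_bigr => j _; rewrite !kact_tens !kact1.
have tr_twirl : \tr (twirl rho) = a%:R * \tr rho.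
  apply: (tens3_additive_ext (f := mxtrace \o twirl) (g := a%:R \*o mxtrace)) => X Y Z /=.
  by rewrite twirlE !mxtrace_tens mxtrace_scalar -(mulr_natl (\tr X)) !mulrA.
(* The total output weight of the twirled input; completeness makes it the input trace, and its
   terms are then compared on product matrices. *)
have <- : \tr (kraus_sum (fun i => A i *t B i *t E i) (twirl rho)) = a%:R * \tr rho.
  rewrite -tr_twirl /kraus_sum raddf_sum /=.
  under eq_bigr => i _ do rewrite -/(kact _ _) mxtrace_kact.
  by rewrite -raddf_sum -mulmx_suml complK mul1mx.
rewrite /kraus_sum raddf_sum; apply: eq_bigr => i _ /=; rewrite -/(kact _ _).
apply: (tens3_additive_ext (f := \tr ((A i)^† *m A i) \*o (mxtrace \o kact (1%:M *t B i *t E i)))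
  (g := mxtrace \o kact (A i *t B i *t E i) \o twirl)) => X Y Z /=.
rewrite twirlE !kact_tens !mxtrace_tens kact1 !mulrA; congr (_ * _ * _).
by rewrite mxtrace_kact mul_mx_scalar linearZ mulrC.
Qed.

Lemma sum_weights_Bob {C : numClosedFieldType} a b c n a' b' c'
  (A : 'I_n -> 'M[C]_(a', a)) (B : 'I_n -> 'M[C]_(b', b)) (E : 'I_n -> 'M[C]_(c', c)) rho :
  \sum_i (A i *t B i *t E i)^† *m (A i *t B i *t E i) = 1%:M ->
  \sum_i \tr ((B i)^† *m B i) * \tr (kact (A i *t (1%:M : 'M_b) *t E i) rho)
    = b%:R * \tr rho.
Proof.
move=> complK.
pose twirl : {linear 'M[C]_(a * b * c) -> 'M[C]_(a * b * c)} :=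
  ksum [seq 1%:M *t delta_mx i j *t 1%:M | i <- index_enum 'I_b, j <- index_enum 'I_b].
have twirlE X Y Z : twirl (X *t Y *t Z) = X *t (\tr Y)%:M *t Z.
  rewrite /twirl /= /ksum big_allpairs_dep -sum_kact_delta tensmx_sumr !tensmx_suml.
  apply: eq_bigr => i _; rewrite tensmx_sumr !tensmx_suml.
  by apply: eq_bigr => j _; rewrite !kact_tens !kact1.
have tr_twirl : \tr (twirl rho) = b%:R * \tr rho.
  apply: (tens3_additive_ext (f := mxtrace \o twirl) (g := b%:R \*o mxtrace)) => X Y Z /=.
  by rewrite twirlE !mxtrace_tens mxtrace_scalar -(mulr_natl (\tr Y)) mulrCA !mulrA.
have <- : \tr (kraus_sum (fun i => A i *t B i *t E i) (twirl rho)) = b%:R * \tr rho.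
  rewrite -tr_twirl /kraus_sum raddf_sum /=.
  under eq_bigr => i _ do rewrite -/(kact _ _) mxtrace_kact.
  by rewrite -raddf_sum -mulmx_suml complK mul1mx.
rewrite /kraus_sum raddf_sum; apply: eq_bigr => i _ /=; rewrite -/(kact _ _).
apply: (tens3_additive_ext (f := \tr ((B i)^† *m B i) \*o (mxtrace \o kact (A i *t 1%:M *t E i)))
  (g := mxtrace \o kact (A i *t B i *t E i) \o twirl)) => X Y Z /=.
rewrite twirlE !kact_tens !mxtrace_tens kact1 !mulrA; congr (_ * _).
rewrite (mxtrace_kact (B i)) mul_mx_scalar linearZ /=.
by ring.
Qed.

(** * Equality cases and extremality of pure states *)

Lemma eq_of_sum_le {C : numClosedFieldType} n (f g : 'I_n -> C) :
  (forall i, f i <= g i) -> \sum_i f i = \sum_i g i -> forall i, f i = g i.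
Proof.
move=> le_fg eq_fg i; apply/eqP; rewrite eq_sym -subr_eq0.
have /eqP : \sum_i (g i - f i) = 0 by rewrite sumrB eq_fg subrr.
rewrite psumr_eq0 => [/allP/(_ i)|j _]; last by rewrite subr_ge0.
by apply; rewrite mem_index_enum.
Qed.

(** Pure states are extremal. The components [y j] orthogonal to [phi] have squared norms adding up
    to the trace of the sum minus its expectation in [phi], which is 1 - 1. *)
Lemma sum_proj_eq_proj {C : numClosedFieldType} n (I : finType)
  (x : I -> 'cV[C]_n) (phi : 'cV[C]_n) :
  sqnorm phi = 1 -> \sum_j proj (x j) = proj phi ->
  forall j, x j = braket phi (x j) *: phi.
Proof.
move=> phi1 sumx.
pose y j := x j - braket phi (x j) *: phi.
have yy j : sqnorm (y j) = sqnorm (x j) - `|braket phi (x j)| ^+ 2.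
  have conj_braket : braket (x j) phi = (braket phi (x j))^*.
    by rewrite /braket -adjmxE adjmxM adjmxK.
  have bZ a u : braket u (a *: phi) = a * braket u phi.
    by rewrite /braket -scalemxAr mxE.
  have y_phi : braket (y j) phi = 0.
    have : braket phi (y j) = 0 by rewrite braketB bZ [braket phi phi]phi1 mulr1 subrr.
    rewrite /braket -[y j]adjmxK -adjmxM adjmxE adjmxK.
    by move=> /(congr1 Num.conj); rewrite conjCK conjC0.
  have -> : sqnorm (y j) = braket (y j) (x j).
    by rewrite /sqnorm [in X in braket _ X]/y braketB bZ y_phi mulr0 subr0.
  have -> : braket (y j) (x j) = (braket (x j) (y j))^*.
    by rewrite /braket -adjmxE adjmxM adjmxK.
  rewrite braketB bZ conj_braket -normCK rmorphB rmorphXn /= conj_normC.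
  by rewrite -/(sqnorm (x j)) conj_Creal// ger0_real// sqnorm_ge0.
have sum_y : \sum_j sqnorm (y j) = 0.
  under eq_bigr do rewrite yy.
  rewrite sumrB; have -> : \sum_j sqnorm (x j) = 1.
    under eq_bigr do rewrite -mxtrace_proj.
    by rewrite -raddf_sum sumx /= mxtrace_proj.
  (* The squared overlaps add up to the expectation of the whole sum in [phi]. *)
  have -> : \sum_j `|braket phi (x j)| ^+ 2 = (phi^† *m (\sum_j proj (x j)) *m phi) 0 0.
    rewrite mulmx_sumr mulmx_suml summxE; apply: eq_bigr => j _.
    rewrite normCK /proj /ketbra !mulmxA -mulmxA mxE big_ord1; congr (_ * _).
    by rewrite /braket -adjmxE adjmxM adjmxK.
  rewrite sumx /proj /ketbra !mulmxA -mulmxA mxE big_ord1.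
  by rewrite -!/(braket _ _) -!/(sqnorm _) phi1 mulr1 subrr.
move=> j; apply/eqP; rewrite -subr_eq0 -sqnorm_eq0.
have /eqP := sum_y; rewrite psumr_eq0 => [/allP/(_ j)|i _]; last exact: sqnorm_ge0.
by apply; rewrite mem_index_enum.
Qed.

(** * Determinant and trace of qubit operators *)

Lemma det_mx2 {C : comNzRingType} (A : 'M[C]_2) :
  \det A = A 0 0 * A 1 1 - A 0 1 * A 1 0.
Proof.
rewrite (expand_det_row _ 0) !big_ord_recl big_ord0 addr0 /cofactor !det_mx11 !mxE /=.
rewrite expr0 expr1 mul1r mulN1r mulrN.
by congr (A _ _ * A _ _ - A _ _ * A _ _); apply/val_inj.
Qed.

Lemma mxtrace_mx2 {C : comNzRingType} (A : 'M[C]_2) : \tr A = A 0 0 + A 1 1.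
Proof.
rewrite /mxtrace !big_ord_recl big_ord0 addr0; congr (_ + A _ _); exact/val_inj.
Qed.

(** The subtracted term is the discriminant of the characteristic polynomial, that is, the squared
    difference of the eigenvalues. Its sign gives the inequality of the means, and its vanishing
    forces a scalar matrix. *)
Lemma hermitian2_det {C : numClosedFieldType} (H : 'M[C]_2) : H^† = H ->
  4 * \det H = \tr H ^+ 2 - ((H 0 0 - H 1 1) ^+ 2 + 4 * `|H 0 1| ^+ 2).
Proof.
move=> HH; have H10 : H 1 0 = (H 0 1)^* by rewrite -{1}HH adjmxE.
by rewrite det_mx2 mxtrace_mx2 normCK H10; ring.
Qed.

Lemma hermitian2_diag_sqr_ge0 {C : numClosedFieldType} (H : 'M[C]_2) : H^† = H ->
  0 <= (H 0 0 - H 1 1) ^+ 2.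
Proof.
move=> HH; have diag_real i : H i i \is Num.real.
  by rewrite CrealE -{2}HH adjmxE.
by rewrite real_exprn_even_ge0// rpredB.
Qed.

Lemma hermitian2_det_le {C : numClosedFieldType} (H : 'M[C]_2) : H^† = H ->
  4 * \det H <= \tr H ^+ 2.
Proof.
move=> HH; rewrite hermitian2_det// lerBlDr lerDl addr_ge0//.
  by rewrite hermitian2_diag_sqr_ge0.
by rewrite mulr_ge0// exprn_ge0.
Qed.

Lemma hermitian2_det_eq {C : numClosedFieldType} (H : 'M[C]_2) : H^† = H ->
  4 * \det H = \tr H ^+ 2 -> H = (\tr H / 2)%:M.
Proof.
move=> HH /eqP; rewrite hermitian2_det// -subr_eq0 addrAC subrr add0r oppr_eq0.
rewrite paddr_eq0 ?hermitian2_diag_sqr_ge0 ?mulr_ge0 ?exprn_ge0//.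
rewrite sqrf_eq0 subr_eq0 mulf_eq0 pnatr_eq0 /= expf_eq0 /= normr_eq0.
move=> /andP[/eqP H00 /eqP H01].
have H10 : H 1 0 = 0 by rewrite -HH adjmxE H01 conjC0.
have tr2 : \tr H / 2 = H 1 1 by rewrite mxtrace_mx2 H00; field.
have ord2 (i : 'I_2) : i = 0 \/ i = 1.
  by case: i => [[|[|//]] ?]; [left|right]; apply/val_inj.
apply/matrixP => i j; rewrite tr2 mxE.
by case: (ord2 i) => ->; case: (ord2 j) => -> /=; rewrite ?eqxx ?mulr1n ?H00 ?H01 ?H10.
Qed.

Lemma adjmx_gram {C : numClosedFieldType} m n (A : 'M[C]_(m, n)) :
  (A^† *m A)^† = A^† *m A.
Proof. by rewrite adjmxM adjmxK. Qed.

Lemma mxtrace_gramE {C : numClosedFieldType} m n (A : 'M[C]_(m, n)) :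
  \tr (A^† *m A) = \sum_i \sum_j `|A j i| ^+ 2.
Proof.
apply: eq_bigr => i _; rewrite mxE; apply: eq_bigr => j _.
by rewrite adjmxE normCK mulrC.
Qed.

Lemma mxtrace_gram_ge0 {C : numClosedFieldType} m n (A : 'M[C]_(m, n)) :
  0 <= \tr (A^† *m A).
Proof.
by rewrite mxtrace_gramE; apply: sumr_ge0 => i _; apply: sumr_ge0 => j _; rewrite exprn_ge0.
Qed.

Lemma mxtrace_gram_eq0 {C : numClosedFieldType} m n (A : 'M[C]_(m, n)) :
  \tr (A^† *m A) = 0 -> A = 0.
Proof.
rewrite mxtrace_gramE => /eqP; rewrite psumr_eq0 => [/allP A0|i _]; last first.
  by apply: sumr_ge0 => j _; rewrite exprn_ge0.
apply/matrixP => j i; rewrite mxE; apply/eqP.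
have := A0 i (mem_index_enum _); rewrite psumr_eq0 => [|k _]; last by rewrite exprn_ge0.
by move=> /allP/(_ j (mem_index_enum _)); rewrite expf_eq0 normr_eq0.
Qed.

(* If a local operation sends the qubit states X_i to multiples p_i / 2 of the
   identity, then 4 p_i^2 = (4 det (A_i^† A_i)) (4 det X_i) is at most
   (tr (A_i^† A_i) tr X_i)^2 by the inequality of the means; when the total
   weights agree, equality holds throughout. *)
Lemma scalar_gram_of_weights {C : numClosedFieldType} n (A X : 'I_n -> 'M[C]_2)
  (p : 'I_n -> C) :
  (forall i, 0 <= p i) -> (forall i, (X i)^† = X i) -> (forall i, 0 <= \tr (X i)) ->
  (forall i, kact (A i) (X i) = (p i / 2)%:M) -> \sum_i p i = 1 ->
  \sum_i \tr ((A i)^† *m A i) * \tr (X i) = 2 ->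
  forall i, p i != 0 -> (A i)^† *m A i = (\tr ((A i)^† *m A i) / 2)%:M.
Proof.
move=> p_ge0 Xherm Xge0 AX sump sumw.
pose H i := (A i)^† *m A i.
have Hge0 i : 0 <= \tr (H i) by exact: mxtrace_gram_ge0.
have detH i : 0 <= \det (H i).
  by rewrite /H det_mulmx /adjmx det_map_mx det_tr mulrC mul_conjC_ge0.
have detHX i : 4 * (p i) ^+ 2 = (4 * \det (H i)) * (4 * \det (X i)).
  have /(congr1 determinant) := AX i; rewrite det_scalar /kact !det_mulmx => EX.
  have -> : p i ^+ 2 = 4 * (p i / 2) ^+ 2 by field.
  by rewrite -EX; ring.
have le1 i : 4 * (p i) ^+ 2 <= (4 * \det (H i)) * \tr (X i) ^+ 2.
  by rewrite detHX ler_wpM2l ?hermitian2_det_le// mulr_ge0.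
have le2 i : (4 * \det (H i)) * \tr (X i) ^+ 2 <= (\tr (H i) * \tr (X i)) ^+ 2.
  by rewrite exprMn ler_wpM2r ?exprn_ge0// hermitian2_det_le// adjmx_gram.
have le3 i : 2 * p i <= \tr (H i) * \tr (X i).
  rewrite -(ler_pXn2r (n := 2))// ?nnegrE ?mulr_ge0//.
  by apply: le_trans (le_trans (le1 i) (le2 i)); rewrite exprMn -natrX.
(* Both sides of [le3] sum to 2, so every instance is an equality. *)
have eq3 := eq_of_sum_le le3 _.
move=> i p_neq0; apply: hermitian2_det_eq; first exact: adjmx_gram.
have {}eq3 : 2 * p i = \tr (H i) * \tr (X i).
  by apply: eq3; rewrite -mulr_sumr sump mulr1 sumw.
have X_neq0 : \tr (X i) != 0.
  by apply: contra_eq_neq eq3 => ->; rewrite mulr0 mulf_neq0// pnatr_eq0.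
apply/le_anti; rewrite hermitian2_det_le ?adjmx_gram//=.
(* After multiplication by the positive square of [\tr (X i)], the reverse inequality is [le1]
   combined with [eq3]. *)
rewrite -(ler_pM2r (x := \tr (X i) ^+ 2)) ?exprn_gt0 ?lt_def ?X_neq0 ?Xge0//.
by apply: le_trans (le1 i); rewrite -exprMn -eq3 exprMn -natrX.
Qed.

(** * From output weights to local unitaries *)

Lemma adjmx_proj {C : numClosedFieldType} n (u : 'cV[C]_n) : (proj u)^† = proj u.
Proof. by rewrite /proj /ketbra adjmxM adjmxK. Qed.

Lemma adjmx_ptrace1 {C : numClosedFieldType} m n (rho : 'M[C]_(m * n)) :
  (ptrace1 rho)^† = ptrace1 (rho^†).
Proof.
apply/matrixP => i j; rewrite adjmxE !mxE rmorph_sum.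
by apply: eq_bigr => k _; rewrite adjmxE.
Qed.

Lemma adjmx_ptrace2 {C : numClosedFieldType} m n (rho : 'M[C]_(m * n)) :
  (ptrace2 rho)^† = ptrace2 (rho^†).
Proof.
apply/matrixP => i j; rewrite adjmxE !mxE rmorph_sum.
by apply: eq_bigr => k _; rewrite adjmxE.
Qed.

Lemma mxtrace_mixed {C : numClosedFieldType} n : n%:R != 0 :> C ->
  \tr ((n%:R^-1)%:M : 'M[C]_n) = 1.
Proof. by move=> n_neq0; rewrite mxtrace_scalar -[LHS]mulr_natl divff. Qed.

(** Both marginals of [omega] are maximally mixed, so the weight argument applies to each qubit
    whenever [p i] is nonzero. The last hypothesis on [K i] is turned into [p i != 0] by counting
    traces. *)
Lemma local_gram_scalar {C : numClosedFieldType} c c' n (A B : 'I_n -> 'M[C]_2)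
  (E : 'I_n -> 'M[C]_(c', c)) (v : 'cV[C]_(2 * 2 * c)) (omega : 'M[C]_(2 * 2)) :
  (0 < c)%N -> ptrace1 (proj v) = (c%:R^-1)%:M ->
  ptrace1 omega = (2^-1)%:M -> ptrace2 omega = (2^-1)%:M ->
  \sum_i (A i *t B i *t E i)^† *m (A i *t B i *t E i) = 1%:M ->
  (forall i, exists p, ptrace2 (proj (A i *t B i *t E i *m v)) = p *: omega) ->
  forall i, A i *t B i *t E i != 0 ->
  exists a b, [/\ 0 < a, 0 < b, (A i)^† *m A i = a%:M & (B i)^† *m B i = b%:M].
Proof.
move=> c_gt0 v_mixed om1 om2 complK out.
have c_neq0 : c%:R != 0 :> C by rewrite pnatr_eq0 -lt0n.
pose K i := A i *t B i *t E i; pose rho := proj v.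
have tr_rho : \tr rho = 1.
  by rewrite -mxtrace_ptrace1 v_mixed mxtrace_mixed.
pose p i := \tr (kact (K i) rho).
have p_ge0 i : 0 <= p i by rewrite /p kact_proj mxtrace_proj sqnorm_ge0.
have sump : \sum_i p i = 1.
  rewrite -tr_rho /p; under eq_bigr do rewrite mxtrace_kact.
  by rewrite -raddf_sum -mulmx_suml complK mul1mx.
have {}out i : ptrace2 (kact (K i) rho) = p i *: omega.
  have [q Eq] := out i; rewrite -[kact _ _]/(kact (K i) (proj v)) kact_proj Eq; congr (_ *: _).
  rewrite /p kact_proj -mxtrace_ptrace2 Eq linearZ /= -mxtrace_ptrace2 om2.
  by rewrite mxtrace_mixed ?mulr1 ?pnatr_eq0.
have AP : forall i, p i != 0 -> (A i)^† *m A i = (\tr ((A i)^† *m A i) / 2)%:M.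
  apply: (scalar_gram_of_weights
    (X := fun i => ptrace2 (ptrace2 (kact (1%:M *t B i *t E i) rho)))) => // [i|i|i|].
  - by rewrite !adjmx_ptrace2 kact_proj adjmx_proj.
  - by rewrite !mxtrace_ptrace2 kact_proj mxtrace_proj sqnorm_ge0.
  (* Charlie's operator is kept inside while [A i] is moved next to [B i], which rebuilds the full
     operator [K i]. *)
  - rewrite ptrace2_kact -ptrace2_kact -ptrace2_kact -/(K i) out linearZ /= om2.
    by rewrite scale_scalar_mx.
  - under eq_bigr do rewrite !mxtrace_ptrace2.
    by rewrite sum_weights_Alice// tr_rho mulr1.
have BP : forall i, p i != 0 -> (B i)^† *m B i = (\tr ((B i)^† *m B i) / 2)%:M.
  apply: (scalar_gram_of_weights
    (X := fun i => ptrace1 (ptrace2 (kact (A i *t 1%:M *t E i) rho)))) => // [i|i|i|].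
  - by rewrite adjmx_ptrace1 adjmx_ptrace2 kact_proj adjmx_proj.
  - by rewrite mxtrace_ptrace1 mxtrace_ptrace2 kact_proj mxtrace_proj sqnorm_ge0.
  - rewrite ptrace2_kact -ptrace1_kact -ptrace2_kact -/(K i) out linearZ /= om1.
    by rewrite scale_scalar_mx.
  - under eq_bigr do rewrite mxtrace_ptrace1 mxtrace_ptrace2.
    by rewrite sum_weights_Bob// tr_rho mulr1.
(* With the grams of [A i] and [B i] scalar, only Charlie's marginal of the input matters for [p i],
   and it is the identity divided by [c]. *)
have trKE i : p i != 0 -> \tr ((K i)^† *m K i) = (4 * c)%:R * p i.
  move=> p_neq0; have := AP i p_neq0; have := BP i p_neq0.
  set a := _ / 2 => BB; set b := _ / 2 => AA.
  rewrite /p -mxtrace_ptrace1 (@ptrace1_kact_scalar _ _ _ _ _ _ _ (b * a)).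
    rewrite v_mixed linearZ /= mxtrace_kact mul_mx_scalar linearZ /=.
    rewrite /K !adjmx_tens !tensmx_mul AA BB !mxtrace_tens !mxtrace_scalar.
    by rewrite natrM; field.
  rewrite adjmx_tens tensmx_mul AA BB -scalemx1 tensmxZl -[a%:M]scalemx1 tensmxZr.
  by rewrite tens11 scalerA scalemx1.
(* Both sides sum to [4 * c], and the left is at most the right also where [p i] vanishes; hence
   equality everywhere. *)
have trK i : (4 * c)%:R * p i = \tr ((K i)^† *m K i).
  move: i; apply: eq_of_sum_le => [j|].
    have [->|/trKE ->//] := eqVneq (p j) 0; by rewrite mulr0 mxtrace_gram_ge0.
  by rewrite -mulr_sumr sump mulr1 -raddf_sum complK /= mxtrace1.
move=> i K_neq0; have p_neq0 : p i != 0.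
  apply: contraNneq K_neq0 => p0; apply/eqP/mxtrace_gram_eq0.
  by rewrite -trK p0 mulr0.
exists (\tr ((A i)^† *m A i) / 2), (\tr ((B i)^† *m B i) / 2).
have gram_gt0 (M : 'M[C]_2) : M != 0 -> 0 < \tr (M^† *m M) / 2.
  move=> M_neq0; rewrite divr_gt0// lt_def mxtrace_gram_ge0 andbT.
  by apply: contraNneq M_neq0 => /mxtrace_gram_eq0 ->.
split; [| |exact: AP|exact: BP]; apply: gram_gt0.
  by apply: contraNneq K_neq0 => ->; rewrite !tens0mx.
by apply: contraNneq K_neq0 => ->; rewrite tensmx0 tens0mx.
Qed.

Lemma unitary_of_gram {C : numClosedFieldType} n (A : 'M[C]_n) a :
  0 < a -> A^† *m A = a%:M -> (sqrtC a)^-1 *: A \is unitarymx.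
Proof.
move=> a_gt0 AA; apply/unitarymx_adjP/mulmx1C.
rewrite adjmxZ -scalemxAl -scalemxAr scalerA AA scale_scalar_mx; congr (_%:M).
rewrite conj_Creal ?ger0_real ?invr_ge0 ?sqrtC_ge0 1?ltW//.
by rewrite -invfM -expr2 sqrtCK mulVf// gt_eqF.
Qed.

(** [Q] abstracts what purity of the required output says about a single Kraus output: a product
    [tensv EPR w], or a multiple of [GHZ]. Kraus operators that vanish are dropped, which later
    gives each [E i] its exact rank. *)
Lemma separable_op_unitary {C : numClosedFieldType} c c'
  (L : 'M[C]_(2 * 2 * c) -> 'M[C]_(2 * 2 * c')) s
  (v : 'cV[C]_(2 * 2 * c)) (omega : 'M[C]_(2 * 2)) (Q : 'cV[C]_(2 * 2 * c') -> Prop) :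
  separable_op L s -> (0 < c)%N -> ptrace1 (proj v) = (c%:R^-1)%:M ->
  ptrace1 omega = (2^-1)%:M -> ptrace2 omega = (2^-1)%:M ->
  (forall y, Q y -> exists p, ptrace2 (proj y) = p *: omega) ->
  (forall n (y : 'I_n -> 'cV[C]_(2 * 2 * c')),
     L (proj v) = \sum_i proj (y i) -> forall i, Q (y i)) ->
  exists (n : nat) (UA UB : 'I_n -> 'M[C]_2) (E : 'I_n -> 'M[C]_(c', c)),
  [/\ forall i, UA i \is unitarymx /\ UB i \is unitarymx,
      forall rho, L rho = kraus_sum (fun i => UA i *t UB i *t E i) rho,
      forall i, E i != 0, \sum_i (E i)^† *m E i = 1%:M &
      forall i, Q (UA i *t UB i *t E i *m v)].
Proof.
move=> [LE complS] c_gt0 v_mixed om1 om2 Qom outQ.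
pose t i := tnth (in_tuple s) i; pose K i := tens3 (t i).
have {}LE rho : L rho = kraus_sum K rho.
  by rewrite LE /ksum big_map big_tnth.
have {}complS : \sum_i (K i)^† *m K i = 1%:M.
  by rewrite -complS /gram big_map [RHS]big_tnth.
have QK i : Q (K i *m v).
  move: i; apply: outQ; rewrite LE; apply: eq_bigr => i _.
  by rewrite -kact_proj.
pose P := [pred i | K i != 0].
have /choice[w wP] : forall j : 'I_#|P|, exists ab : C * C,
    [/\ 0 < ab.1, 0 < ab.2, (t (enum_val j)).1.1^† *m (t (enum_val j)).1.1 = ab.1%:M &
      (t (enum_val j)).1.2^† *m (t (enum_val j)).1.2 = ab.2%:M].
  move=> j; have Kj : K (enum_val j) != 0 by have := enum_valP j.
  have [a [b H]] := local_gram_scalar (A := fun i => (t i).1.1)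
    (B := fun i => (t i).1.2) (E := fun i => (t i).2) c_gt0 v_mixed om1 om2 complS
    (fun i => Qom _ (QK i)) Kj.
  by exists (a, b).
pose UA j := (sqrtC (w j).1)^-1 *: (t (enum_val j)).1.1.
pose UB j := (sqrtC (w j).2)^-1 *: (t (enum_val j)).1.2.
(* The factors that normalize Alice's and Bob's operators are moved to Charlie, so the product is
   unchanged. *)
pose E j := (sqrtC (w j).1 * sqrtC (w j).2) *: (t (enum_val j)).2.
have KE j : UA j *t UB j *t E j = K (enum_val j).
  have [a_gt0 b_gt0 _ _] := wP j.
  rewrite /UA /UB /E !(tensmxZl, tensmxZr) !scalerA [X in X *: _](_ : _ = 1).
    by rewrite scale1r.
  by field; rewrite !sqrtC_eq0 !gt_eqF.
have UAB j : UA j \is unitarymx /\ UB j \is unitarymx.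
  by have [a_gt0 b_gt0 AA BB] := wP j; split; exact: unitary_of_gram.
exists #|P|, UA, UB, E; split=> //.
- move=> rho; rewrite LE /kraus_sum (bigID P) /= [X in _ + X]big1 => [|i].
    by rewrite addr0 big_enum_val; apply: eq_bigr => j _; rewrite -KE.
  by rewrite negbK => /eqP->; rewrite !mul0mx.
- move=> j; have : K (enum_val j) != 0 by have := enum_valP j.
  by rewrite -KE; apply: contra_neq => ->; rewrite tensmx0.
- have EE j : (K (enum_val j))^† *m K (enum_val j) = 1%:M *t ((E j)^† *m E j).
    have [/unitarymx_adjP/mulmx1C UAj /unitarymx_adjP/mulmx1C UBj] := UAB j.
    by rewrite -KE !adjmx_tens !tensmx_mul UAj UBj tens11.
  have : \sum_(j < #|P|) 1%:M *t ((E j)^† *m E j) = 1%:M :> 'M[C]_(2 * 2 * c).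
    rewrite -complS [RHS](bigID P) /= [X in _ = _ + X]big1 => [|i].
      by rewrite addr0 [RHS]big_enum_val; apply: eq_bigr => j _; rewrite EE.
    by rewrite negbK => /eqP->; rewrite mulmx0.
  (* Tracing out Alice and Bob leaves Charlie's completeness relation multiplied by 4. *)
  rewrite -tensmx_sumr -[RHS]tens11 => /(congr1 ptrace1); rewrite !ptrace1_tens mxtrace1.
  by move=> /scalerI; apply; rewrite pnatr_eq0.
- by move=> j; rewrite KE.
Qed.

(** * The three kinds of boxes *)

Lemma tensvE {C : numClosedFieldType} m n (u : 'cV[C]_m) (w : 'cV[C]_n) i k :
  tensv u w (mxtens_index (i, k)) 0 = u i 0 * w k 0.
Proof. by rewrite mxE mxtens_indexK /=; congr (u _ _ * w _ _); rewrite ord1. Qed.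

Lemma proj_tensv {C : numClosedFieldType} m n (u : 'cV[C]_m) (w : 'cV[C]_n) :
  proj (tensv u w) = proj u *t proj w.
Proof. by have := tensmx_mul u w u^† w^†; rewrite -adjmx_tens. Qed.

Lemma mul_tensv {C : numClosedFieldType} m n m' n' (A : 'M[C]_(m', m))
  (B : 'M[C]_(n', n)) (u : 'cV[C]_m) (w : 'cV[C]_n) :
  (A *t B) *m tensv u w = tensv (A *m u) (B *m w).
Proof. exact: (tensmx_mul A B u w). Qed.

Lemma projZ {C : numClosedFieldType} n a (u : 'cV[C]_n) :
  proj (a *: u) = `|a| ^+ 2 *: proj u.
Proof. by rewrite /proj /ketbra adjmxZ -scalemxAl -scalemxAr scalerA normCK. Qed.

Lemma colP_tens {C : numClosedFieldType} m n (u v : 'cV[C]_(m * n)) :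
  (forall i k, u (mxtens_index (i, k)) 0 = v (mxtens_index (i, k)) 0) -> u = v.
Proof.
by move=> uv; apply/colP => x; case: (mxtens_indexP x) => i k; exact: uv.
Qed.

(** The slices of the [y i] along a basis of the traced factor decompose [proj phi], so by
    extremality each is a multiple of [phi]; the multiples are the coordinates of [w]. *)
Lemma ptrace2_pure {C : numClosedFieldType} m k n (y : 'I_n -> 'cV[C]_(m * k))
  (phi : 'cV[C]_m) : sqnorm phi = 1 -> ptrace2 (\sum_i proj (y i)) = proj phi ->
  forall i, exists w, y i = tensv phi w.
Proof.
move=> phi1 Ey; pose slice (p : 'I_n * 'I_k) : 'cV_m := \col_a y p.1 (mxtens_index (a, p.2)) 0.
have : \sum_p proj (slice p) = proj phi.
  rewrite -Ey raddf_sum -(pair_bigA _ (fun i j => proj (slice (i, j)))) /=.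
  apply: eq_bigr => i _; apply/matrixP => a b; rewrite summxE mxE.
  by apply: eq_bigr => j _; rewrite !mxE !big_ord1 !mxE.
move=> /(sum_proj_eq_proj phi1) sliceE i.
exists (\col_j braket phi (slice (i, j))); apply: colP_tens => a j.
rewrite tensvE mxE mulrC; have /colP/(_ a) := sliceE (i, j).
by rewrite [LHS]mxE => ->; rewrite mxE.
Qed.

Lemma ord2_ind (P : 'I_2 -> Prop) : P 0 -> P 1 -> forall i, P i.
Proof.
move=> P0 P1 [[|[|//]] lt_i2].
  by rewrite (_ : Ordinal _ = 0)//; apply/val_inj.
by rewrite (_ : Ordinal _ = 1)//; apply/val_inj.
Qed.

Lemma sum_ord2 (V : nmodType) (F : 'I_2 -> V) : \sum_i F i = F 0 + F 1.
Proof. by rewrite !big_ord_recl big_ord0 addr0; congr (_ + F _); apply/val_inj. Qed.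

Lemma EPRE {C : numClosedFieldType} i j :
  EPR (mxtens_index (i, j)) 0 = (sqrtC 2)^-1 * (i == j)%:R :> C.
Proof.
rewrite mxE addmxE !tensvE !mxE !andbT; congr (_ * _).
by elim/ord2_ind: i; elim/ord2_ind: j; rewrite /= ?mulr1 ?mulr0 ?addr0 ?add0r.
Qed.

Lemma GHZE {C : numClosedFieldType} i j k :
  GHZ (mxtens_index (mxtens_index (i, j), k)) 0 =
    (sqrtC 2)^-1 * ((i == j) && (j == k))%:R :> C.
Proof.
rewrite mxE addmxE !tensvE !mxE !andbT; congr (_ * _).
by elim/ord2_ind: i; elim/ord2_ind: j; elim/ord2_ind: k;
  rewrite /= ?mulr1 ?mulr0 ?addr0 ?add0r.
Qed.

Lemma invsqrt2K {C : numClosedFieldType} : (sqrtC 2)^-1 * (sqrtC 2)^-1 = 2^-1 :> C.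
Proof. by rewrite -invfM -expr2 sqrtCK. Qed.

Lemma invsqrt2_real {C : numClosedFieldType} : ((sqrtC 2)^-1 : C)^* = (sqrtC 2)^-1.
Proof. by rewrite conj_Creal// ger0_real// invr_ge0 sqrtC_ge0. Qed.

(** Two EPR pairs are a single maximally entangled vector of dimension 4 between [AB] and [C]. *)
Lemma EPR_AC1_BC2E {C : numClosedFieldType} x c :
  EPR_AC1_BC2 (mxtens_index (x, c)) 0 = 2^-1 * (x == c)%:R :> C.
Proof.
case: (mxtens_indexP x) => a b; case: (mxtens_indexP c) => c1 c2.
rewrite mxE !mxtens_indexK !EPRE mulrACA invsqrt2K.
by rewrite (can_eq (@mxtens_indexK _ _)) xpair_eqE; case: eqP; case: eqP;
  rewrite /= ?mulr1 ?mulr0 ?mul0r.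
Qed.

Lemma ptrace1_EPR_AC1_BC2 {C : numClosedFieldType} :
  ptrace1 (proj EPR_AC1_BC2) = ((2 * 2)%:R^-1)%:M :> 'M[C]_(2 * 2).
Proof.
apply/matrixP => c d; rewrite !mxE (bigD1 c)//= big1 => [|x /negbTE neq].
  rewrite mxE big_ord1 adjmxE !EPR_AC1_BC2E eqxx addr0 rmorphM fmorphV !rmorph_nat.
  by rewrite natrM invfM; case: (c == d); rewrite ?mulr1 ?mulr0.
by rewrite mxE big_ord1 EPR_AC1_BC2E neq mulr0 mul0r.
Qed.

Lemma ketbraE {C : numClosedFieldType} m n (u : 'cV[C]_m) (v : 'cV[C]_n) i j :
  ketbra u v i j = u i 0 * (v j 0)^*.
Proof. by rewrite mxE big_ord1 adjmxE. Qed.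

Lemma projE {C : numClosedFieldType} n (u : 'cV[C]_n) i j :
  proj u i j = u i 0 * (u j 0)^*.
Proof. by rewrite mxE big_ord1 adjmxE. Qed.

Lemma sqrt2_weight {C : numClosedFieldType} (b b' : bool) :
  (sqrtC 2)^-1 * b%:R * ((sqrtC 2)^-1 * b'%:R)^* = 2^-1 * (b && b')%:R :> C.
Proof. by rewrite rmorphM rmorph_nat /= invsqrt2_real mulrACA invsqrt2K -natrM mulnb. Qed.

Lemma ptrace1_GHZ {C : numClosedFieldType} :
  ptrace1 (proj GHZ) = (2^-1)%:M :> 'M[C]_2.
Proof.
apply/matrixP => c d; rewrite !mxE sum_mxtens !sum_ord2 !projE !GHZE !sqrt2_weight.
by elim/ord2_ind: c; elim/ord2_ind: d; rewrite /= ?mulr1 ?mulr0 ?addr0 ?add0r.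
Qed.

Lemma ptrace1_ptrace2_GHZ {C : numClosedFieldType} :
  ptrace1 (ptrace2 (proj GHZ)) = (2^-1)%:M :> 'M[C]_2.
Proof.
apply/matrixP => c d; rewrite !mxE; under eq_bigr do rewrite mxE.
rewrite !sum_ord2 !projE !GHZE !sqrt2_weight.
by elim/ord2_ind: c; elim/ord2_ind: d; rewrite /= ?mulr1 ?mulr0 ?addr0 ?add0r.
Qed.

Lemma ptrace2_ptrace2_GHZ {C : numClosedFieldType} :
  ptrace2 (ptrace2 (proj GHZ)) = (2^-1)%:M :> 'M[C]_2.
Proof.
apply/matrixP => c d; rewrite !mxE; under eq_bigr do rewrite mxE.
rewrite !sum_ord2 !projE !GHZE !sqrt2_weight.
by elim/ord2_ind: c; elim/ord2_ind: d; rewrite /= ?mulr1 ?mulr0 ?addr0 ?add0r.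
Qed.

Lemma max_entangled_EPR {C : numClosedFieldType} : max_entangled (EPR : 'cV[C]_(2 * 2)).
Proof.
by split; apply/matrixP => c d; rewrite !mxE sum_ord2 !projE !EPRE !sqrt2_weight;
  elim/ord2_ind: c; elim/ord2_ind: d; rewrite /= ?mulr1 ?mulr0 ?addr0 ?add0r.
Qed.

Lemma max_entangled_sqnorm {C : numClosedFieldType} d (psi : 'cV[C]_(d * d)) :
  (0 < d)%N -> max_entangled psi -> sqnorm psi = 1.
Proof.
move=> d_gt0 [psi1 _]; rewrite -mxtrace_proj -mxtrace_ptrace1 psi1 mxtrace_mixed//.
by rewrite pnatr_eq0 -lt0n.
Qed.

(** For each marginal, one unitary disappears under the trace and the other fixes scalar
    matrices. *)
Lemma max_entangled_unitary {C : numClosedFieldType} d (U V : 'M[C]_d)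
  (psi : 'cV[C]_(d * d)) : U \is unitarymx -> V \is unitarymx ->
  max_entangled psi -> max_entangled ((U *t V) *m psi).
Proof.
move=> /unitarymx_adjP UU /unitarymx_adjP VV [psi1 psi2].
have kact_mixed (W : 'M[C]_d) a : W *m W^† = 1%:M -> kact W a%:M = a%:M.
  by move=> WW; rewrite /kact mul_mx_scalar -scalemxAl WW scalemx1.
split; rewrite -kact_proj.
  by rewrite (ptrace1_kact_scalar _ _ (mulmx1C UU)) scale1r psi1 kact_mixed.
by rewrite (ptrace2_kact_scalar _ _ (mulmx1C VV)) scale1r psi2 kact_mixed.
Qed.

Lemma mul_tens1E {C : numClosedFieldType} a c c' (E : 'M[C]_(c', c))
  (v : 'cV[C]_(a * c)) x k :
  (((1%:M : 'M_a) *t E) *m v) (mxtens_index (x, k)) 0 =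
    \sum_l E k l * v (mxtens_index (x, l)) 0.
Proof.
rewrite mxE sum_mxtens (bigD1 x)//= [X in _ + X]big1 => [|y /negbTE neq].
  by rewrite addr0; apply: eq_bigr => l _; rewrite tensmxE mxE eqxx mul1r.
by apply: big1 => l _; rewrite tensmxE mxE eq_sym neq !mul0r.
Qed.

Lemma undo_unitary {C : numClosedFieldType} a c c' (U : 'M[C]_a)
  (E : 'M[C]_(c', c)) (v : 'cV_(a * c)) (y : 'cV_(a * c')) :
  U \is unitarymx -> (U *t E) *m v = y ->
  ((1%:M : 'M_a) *t E) *m v = (U^† *t 1%:M) *m y.
Proof.
by move=> /unitarymx_adjP/mulmx1C UU <-; rewrite mulmxA tensmx_mul UU mul1mx.
Qed.

Lemma tens_unitary {C : numClosedFieldType} a b (U : 'M[C]_a) (V : 'M[C]_b) :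
  U \is unitarymx -> V \is unitarymx -> U *t V \is unitarymx.
Proof.
move=> /unitarymx_adjP UU /unitarymx_adjP VV; apply/unitarymx_adjP.
by rewrite adjmx_tens tensmx_mul UU VV tens11.
Qed.

Lemma adj_unitary {C : numClosedFieldType} a (U : 'M[C]_a) :
  (U^† \is unitarymx) = (U \is unitarymx).
Proof. exact: trmxC_unitary. Qed.

Lemma rank_ketbra {C : numClosedFieldType} m n (u : 'cV[C]_m) (v : 'cV[C]_n) :
  ketbra u v != 0 -> \rank (ketbra u v) = 1%N.
Proof.
move=> uv_neq0; apply/eqP; rewrite eqn_leq lt0n mxrank_eq0 uv_neq0 andbT.
by rewrite (leq_trans (mxrankM_maxl _ _))// rank_leq_col.
Qed.

Lemma gram_ketbra {C : numClosedFieldType} m n (u : 'cV[C]_m) (v : 'cV[C]_n) :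
  (ketbra u v)^† *m ketbra u v = sqnorm u *: proj v.
Proof.
rewrite /ketbra adjmxM adjmxK -mulmxA (mulmxA _ u) [u^† *m u]mx11_scalar.
by rewrite mul_scalar_mx -scalemxAr.
Qed.

(** Applied to the maximally entangled input, [E i] is merely reshaped and halved. Once the local
    unitaries are undone, the result is a product of a rotated [EPR] and a vector of Charlie, which
    is a rank-one matrix. *)
Lemma ES_box_form {C : numClosedFieldType} c'
  (L : 'M[C]_(2 * 2 * (2 * 2)) -> 'M[C]_(2 * 2 * c')) :
  ES_box L ->
  exists (n : nat) (UA UB : 'I_n -> 'M[C]_2) (E : 'I_n -> 'M[C]_(c', 2 * 2)),
  [/\ forall i, UA i \is unitarymx,
      forall i, UB i \is unitarymx,
      forall rho, L rho = kraus_sum (fun i => UA i *t UB i *t E i) rho &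
      exists (u : 'I_n -> 'cV[C]_c') (psi : 'I_n -> 'cV[C]_(2 * 2)),
      [/\ forall i, \rank (E i) = 1%N /\ E i = ketbra (u i) (psi i),
          forall i, sqnorm (psi i) = 1 /\ max_entangled (psi i),
          \sum_i (E i)^† *m E i = \sum_i sqnorm (u i) *: proj (psi i) &
          \sum_i sqnorm (u i) *: proj (psi i) = 1%:M]].
Proof.
move=> [/locc_separable[s sepL] outL].
have EPR1 : sqnorm (EPR : 'cV[C]_(2 * 2)) = 1.
  exact: max_entangled_sqnorm max_entangled_EPR.
have [|y [w ->]|n y Ey|n [UA [UB [E [UU LE E_neq0 complE QK]]]]] :=
  separable_op_unitary (Q := fun y => exists w, y = tensv EPR w) sepL _
    ptrace1_EPR_AC1_BC2 max_entangled_EPR.1 max_entangled_EPR.2.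
- by [].
- by exists (\tr (proj w)); rewrite proj_tensv ptrace2_tens.
- by apply: (ptrace2_pure EPR1); rewrite -Ey.
have [w wP] := choice QK.
(* The factor 2 cancels the amplitude 1/2 of the input. The transposes in [psi] are the conjugates
   of the adjoints that undo the unitaries: [ketbra] conjugates its second argument, and [EPR] is
   real. *)
pose u i : 'cV_c' := 2 *: w i.
pose psi i : 'cV[C]_(2 * 2) := ((UA i)^T *t (UB i)^T) *m EPR.
have EE i : E i = ketbra (u i) (psi i).
  have [UAi UBi] := UU i.
  have := undo_unitary (tens_unitary UAi UBi) (wP i).
  rewrite mul_tensv mul1mx => Ew.
  apply/matrixP => k x; have /colP/(_ (mxtens_index (x, k))) := Ew.
  rewrite tensvE mul_tens1E (bigD1 x)//= big1 => [|l /negbTE neq]; last first.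
    by rewrite EPR_AC1_BC2E eq_sym neq !mulr0.
  rewrite EPR_AC1_BC2E eqxx mulr1 addr0 => Ekx.
  have -> : E i k x = 2 * (E i k x * 2^-1) by field.
  rewrite Ekx ketbraE [u i k 0]mxE -mulrA; congr (2 * _).
  rewrite mulrC; congr (_ * _); rewrite !mxE rmorph_sum; apply: eq_bigr => z _.
  rewrite rmorphM /=; congr (_ * _).
    by rewrite adjmx_tens !mxE rmorphM.
  by case: (mxtens_indexP z) => a b; rewrite EPRE rmorphM rmorph_nat /= invsqrt2_real.
exists n, UA, UB, E; split=> // [i|i|]; [exact: (UU i).1|exact: (UU i).2|].
have sumE : \sum_i (E i)^† *m E i = \sum_i sqnorm (u i) *: proj (psi i).
  by apply: eq_bigr => i _; rewrite EE gram_ketbra.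
exists u, psi; split=> // [i|i|]; last by rewrite -sumE.
  by split=> //; rewrite EE rank_ketbra// -EE.
have psi_max : max_entangled (psi i).
  apply: max_entangled_unitary max_entangled_EPR; rewrite trmx_unitary; by have [] := UU i.
by split=> //; exact: max_entangled_sqnorm.
Qed.

(** The same reshaping as for an ES-box, now of a rotated [GHZ]: its two terms give the two terms of
    [E i]. *)
Lemma EPR2_GHZ_box_form {C : numClosedFieldType}
  (L : 'M[C]_(2 * 2 * (2 * 2)) -> 'M[C]_(2 * 2 * 2)) :
  EPR2_GHZ_box L ->
  exists (n : nat) (UA UB : 'I_n -> 'M[C]_2) (E : 'I_n -> 'M[C]_(2, 2 * 2)),
  [/\ forall i, UA i \is unitarymx,
      forall i, UB i \is unitarymx,
      forall rho, L rho = kraus_sum (fun i => UA i *t UB i *t E i) rho &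
      exists (coef : 'I_n -> C) (c : 'I_2 -> 'cV[C]_2)
        (a b : 'I_n -> 'I_2 -> 'cV[C]_2),
      [/\ forall i, \rank (E i) = 2%N /\
            E i = coef i *: (ketbra (c 0) (tensv (a i 0) (b i 0)) +
                             ketbra (c 1) (tensv (a i 1) (b i 1))),
          forall r s, braket (c r) (c s) = (r == s)%:R,
          forall i r s, braket (a i r) (a i s) = (r == s)%:R /\
                        braket (b i r) (b i s) = (r == s)%:R &
          \sum_i `|coef i| ^+ 2 *: (proj (tensv (a i 0) (b i 0)) +
                                    proj (tensv (a i 1) (b i 1))) = 1%:M]].
Proof.
move=> [/locc_separable[s sepL] outL].
have GHZ1 : sqnorm (GHZ : 'cV[C]_(2 * 2 * 2)) = 1.
  by rewrite -mxtrace_proj -mxtrace_ptrace1 ptrace1_GHZ mxtrace_mixed// pnatr_eq0.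
have [|y [l ->]|n y Ey|n [UA [UB [E [UU LE E_neq0 complE QK]]]]] :=
  separable_op_unitary (Q := fun y => exists l, y = l *: GHZ) sepL _
    ptrace1_EPR_AC1_BC2 ptrace1_ptrace2_GHZ ptrace2_ptrace2_GHZ.
- by [].
- by exists (`|l| ^+ 2); rewrite projZ linearZ.
- by move=> i; exists (braket GHZ (y i)); apply: sum_proj_eq_proj; rewrite // -Ey.
have [l lP] := choice QK.
(* The rows of the local unitaries, as columns; their orthonormality is unitarity. *)
pose a i r : 'cV_2 := \col_x UA i r x.
pose b i r : 'cV_2 := \col_x UB i r x.
pose t i r := tensv (a i r) (b i r).
pose W i := ketbra (ket 0) (t i 0) + ketbra (ket 1) (t i 1).
(* The 2 cancels the input amplitude, and the inverse root is the amplitude of [GHZ]. *)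
pose coef i := 2 * (sqrtC 2)^-1 * l i.
have WE i k x : W i k x = (t i k x 0)^*.
  rewrite addmxE !mxE !big_ord1 !adjmxE !mxE andbT.
  by elim/ord2_ind: k; rewrite /= mul1r mul0r ?addr0 ?add0r.
have EE i : E i = coef i *: W i.
  have [UAi UBi] := UU i.
  have Ew := undo_unitary (tens_unitary UAi UBi) (lP i).
  apply/matrixP => k x; have /colP/(_ (mxtens_index (x, k))) := Ew.
  rewrite mul_tens1E (bigD1 x)//= big1 => [|z /negbTE neq]; last first.
    by rewrite EPR_AC1_BC2E eq_sym neq !mulr0.
  rewrite EPR_AC1_BC2E eqxx mulr1 addr0 => Ekx.
  have -> : E i k x = 2 * (E i k x * 2^-1) by field.
  rewrite Ekx {Ekx} -scalemxAr [RHS]mxE WE /coef -!mulrA; congr (2 * _).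
  rewrite [RHS]mulrCA [LHS]mxE; congr (l i * _).
  case: (mxtens_indexP x) => x1 x2; rewrite tensvE [a _ _ _ _]mxE [b _ _ _ _]mxE.
  rewrite [LHS]mxE !sum_mxtens !sum_ord2 !GHZE !adjmx_tens !tensmxE !adjmxE !mxE.
  by elim/ord2_ind: k; rewrite /= ?mulr1 ?mulr0 ?mul0r ?addr0 ?add0r rmorphM mulrC.
have orth (U : 'M[C]_2) r q : U \is unitarymx ->
    braket (\col_x U r x) (\col_x U q x) = (r == q)%:R.
  move=> /unitarymx_adjP/matrixP/(_ q r); rewrite braketE !mxE eq_sym => <-.
  by apply: eq_bigr => y _; rewrite adjmxE !mxE mulrC.
have tt i r q : braket (t i r) (t i q) = (r == q)%:R.
  have [UAi UBi] := UU i.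
  have -> : braket (t i r) (t i q) = braket (a i r) (a i q) * braket (b i r) (b i q).
    rewrite !braketE sum_mxtens mulr_suml; apply: eq_bigr => x _.
    rewrite mulr_sumr; apply: eq_bigr => y _.
    by rewrite !tensvE rmorphM mulrACA.
  by rewrite !orth// -natrM mulnb andbb.
(* For a rectangular matrix this says that the rows are orthonormal, so [W i] has rank 2. *)
have WW i : W i \is unitarymx.
  apply/unitarymx_adjP/matrixP => r q; rewrite [RHS]mxE -(tt i) braketE [LHS]mxE.
  by apply: eq_bigr => x _; rewrite adjmxE !WE conjCK.
have gramW i : (W i)^† *m W i = proj (t i 0) + proj (t i 1).
  apply/matrixP => x y; rewrite addmxE !projE mxE sum_ord2.
  by rewrite !adjmxE !WE !conjCK.
have coef_neq0 i : coef i != 0.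
  by apply: contraNneq (E_neq0 i) => coef0; rewrite EE coef0 scale0r.
exists n, UA, UB, E; split=> // [i|i|]; [exact: (UU i).1|exact: (UU i).2|].
exists coef, ket, a, b; split=> [i|r q|i r q|].
- by split; rewrite EE// mxrank_scale_nz// mxrank_unitary.
- rewrite braketE sum_ord2 !mxE !andbT.
  by elim/ord2_ind: r; elim/ord2_ind: q; rewrite /= ?conjC0 ?conjC1 ?mulr1 ?mulr0 ?addr0 ?add0r.
- by have [UAi UBi] := UU i; rewrite !orth.
- rewrite -complE; apply: eq_bigr => i _; rewrite EE adjmxZ -scalemxAl -scalemxAr.
  by rewrite scalerA gramW normCK mulrC.
Qed.

(** The input vanishes unless Alice's and Bob's indices agree, so the rotated EPR vector [chi i] is
    diagonal. Being maximally entangled, it has diagonal entries of equal modulus, and only a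
    relative phase is left. *)
Lemma GHZ_EPR_box_form {C : numClosedFieldType} c'
  (L : 'M[C]_(2 * 2 * 2) -> 'M[C]_(2 * 2 * c')) :
  GHZ_EPR_box L ->
  exists (n : nat) (UA UB : 'I_n -> 'M[C]_2) (E : 'I_n -> 'M[C]_(c', 2)),
  [/\ forall i, UA i \is unitarymx,
      forall i, UB i \is unitarymx,
      forall rho, L rho = kraus_sum (fun i => UA i *t UB i *t E i) rho &
      exists (u : 'I_n -> 'cV[C]_c') (z : 'I_n -> C),
      let psi i := (sqrtC 2)^-1 *: (ket 0 + z i *: ket 1) in
      [/\ forall i, `|z i| = 1,
          forall i, \rank (E i) = 1%N /\ E i = ketbra (u i) (psi i),
          \sum_i (E i)^† *m E i = \sum_i sqnorm (u i) *: proj (psi i) &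
          \sum_i sqnorm (u i) *: proj (psi i) = 1%:M]].
Proof.
move=> [/locc_separable[s sepL] outL].
have EPR1 : sqnorm (EPR : 'cV[C]_(2 * 2)) = 1.
  exact: max_entangled_sqnorm max_entangled_EPR.
have [|y [w ->]|n y Ey|n [UA [UB [E [UU LE E_neq0 complE QK]]]]] :=
  separable_op_unitary (Q := fun y => exists w, y = tensv EPR w) sepL _
    ptrace1_GHZ max_entangled_EPR.1 max_entangled_EPR.2.
- by [].
- by exists (\tr (proj w)); rewrite proj_tensv ptrace2_tens.
- by apply: (ptrace2_pure EPR1); rewrite -Ey.
have [w wP] := choice QK.
pose chi i : 'cV[C]_(2 * 2) := (UA i *t UB i)^† *m EPR.
pose x i a b := chi i (mxtens_index (a, b)) 0.
have Ew i k a b : (sqrtC 2)^-1 * (E i k a * (a == b)%:R) = x i a b * w i k 0.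
  have [UAi UBi] := UU i.
  have := undo_unitary (tens_unitary UAi UBi) (wP i).
  rewrite mul_tensv mul1mx -/(chi i) => /colP/(_ (mxtens_index (mxtens_index (a, b), k))).
  rewrite tensvE mul_tens1E -/(x i a b) => <-; rewrite sum_ord2 !GHZE.
  elim/ord2_ind: a; elim/ord2_ind: b; rewrite /= ?(mulr1, mulr0, addr0, add0r)//;
    by rewrite mulrC.
have w_neq0 i : w i != 0.
  apply: contraNneq (E_neq0 i) => w0; apply/eqP/matrixP => k a; apply/eqP.
  have w0k : w i k 0 = 0 by rewrite w0 mxE.
  have /eqP := Ew i k a a; rewrite w0k eqxx mulr1 mulr0 mulf_eq0.
  by rewrite invr_eq0 sqrtC_eq0 pnatr_eq0 /= mxE.
have x_off i a b : a != b -> x i a b = 0.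
  move=> /negbTE ab; apply/eqP; have := w_neq0 i; apply: contraNT => x_neq0.
  apply/eqP/colP => k; rewrite [RHS]mxE; apply: (mulfI x_neq0).
  by rewrite -Ew ab !mulr0.
have x_diag i a : `|x i a a| ^+ 2 = 2^-1.
  have [UAi UBi] := UU i.
  have [_] : max_entangled (chi i).
    rewrite /chi adjmx_tens; apply: max_entangled_unitary max_entangled_EPR;
      by rewrite adj_unitary.
  move=> /matrixP/(_ a a); rewrite [RHS]mxE eqxx mulr1n => <-.
  rewrite mxE (bigD1 a)//= big1 ?addr0 => [|b ba]; first by rewrite projE normCK.
  by rewrite projE -/(x i a b) x_off 1?eq_sym// mul0r.
have x_neq0 i a : x i a a != 0.
  by rewrite -normr_eq0 -sqrf_eq0 x_diag invr_eq0 pnatr_eq0.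
pose u i : 'cV_c' := (2 * x i 0 0) *: w i.
(* The relative phase of the diagonal entries, conjugated because [psi i] enters [E i] as a bra; the
   common factor [x i 0 0] goes into [u i]. *)
pose z i := (x i 1 1 / x i 0 0)^*.
pose psi i : 'cV[C]_2 := (sqrtC 2)^-1 *: (ket 0 + z i *: ket 1).
have sqrt2_neq0 : sqrtC 2 != 0 :> C by rewrite sqrtC_eq0 pnatr_eq0.
have EE i : E i = ketbra (u i) (psi i).
  have Ex k a : E i k a = sqrtC 2 * (x i a a * w i k 0).
    by rewrite -Ew eqxx mulr1 mulVKf.
  have two : 2 = sqrtC 2 * sqrtC 2 :> C by rewrite -expr2 sqrtCK.
  apply/matrixP => k a; rewrite ketbraE Ex !mxE /= !andbT rmorphM /= invsqrt2_real.
  rewrite rmorphD rmorphM /= /z conjCK !rmorph_nat.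
  move: sqrt2_neq0 two; set r := sqrtC 2; clearbody r => r_neq0 ->.
  by elim/ord2_ind: a => /=; field; rewrite ?r_neq0 ?x_neq0.
exists n, UA, UB, E; split=> // [i|i|]; [exact: (UU i).1|exact: (UU i).2|].
have sumE : \sum_i (E i)^† *m E i = \sum_i sqnorm (u i) *: proj (psi i).
  by apply: eq_bigr => i _; rewrite EE gram_ketbra.
exists u, z; split=> // [i|i|]; last by rewrite -sumE.
  rewrite /z norm_conjC normf_div.
  have -> : `|x i 1 1| = `|x i 0 0|.
    by apply: (pexpIrn (n := 2)); rewrite ?nnegrE// !x_diag.
  by rewrite divff// normr_eq0.
by split=> //; rewrite EE rank_ketbra// -EE.
Qed.

(** * Real angles for the phases, and the final statement *)

Lemma cis_surj (R : realType) (z : R[i]) : `|z| = 1 -> exists t, z = cis t.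
Proof.
case: z => x y; rewrite normc_def /= => -[].
move=> /(congr1 (fun r => r ^+ 2)); rewrite sqr_sqrtr ?addr_ge0 ?sqr_ge0// expr1n => xy1.
have x1 : -1 <= x <= 1.
  rewrite -ler_norml -(ler_pXn2r (n := 2))// ?nnegrE// expr1n.
  by rewrite real_normK ?num_real// -xy1 lerDl sqr_ge0.
have y2 : 1 - x ^+ 2 = y ^+ 2 by rewrite -xy1 addrAC subrr add0r.
have cosx : cos (acos x) = x by rewrite acosK// in_itv.
(* The arccosine of [x] has nonnegative sine, so the sign of [y] selects the angle or its
   opposite. *)
have [y_ge0|/ltW y_le0] := leP 0 y.
  by exists (acos x); rewrite /cis sin_acos// cosx y2 sqrtr_sqr ger0_norm.
exists (- acos x); rewrite /cis cosN sinN sin_acos// cosx y2 sqrtr_sqr ler0_norm//.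
by rewrite opprK.
Qed.

Theorem theorem1 (R : realType) :
  [/\ (* ES *)
      forall (c' : nat)
        (L : 'M[R[i]]_(2 * 2 * (2 * 2)) -> 'M[R[i]]_(2 * 2 * c')),
      ES_box L ->
      exists (n : nat) (UA UB : 'I_n -> 'M[R[i]]_2)
        (E : 'I_n -> 'M[R[i]]_(c', 2 * 2)),
      [/\ forall i, UA i \is unitarymx,
          forall i, UB i \is unitarymx,
          forall rho, density rho ->
            ptrace2 (L rho) =
            ptrace2 (kraus_sum (fun i => UA i *t UB i *t E i) rho) &
          exists (u : 'I_n -> 'cV[R[i]]_c') (psi : 'I_n -> 'cV[R[i]]_(2 * 2)),
          [/\ forall i, \rank (E i) = 1%N /\ E i = ketbra (u i) (psi i),
              forall i, sqnorm (psi i) = 1 /\ max_entangled (psi i),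
              \sum_i (E i)^† *m E i = \sum_i sqnorm (u i) *: proj (psi i) &
              \sum_i sqnorm (u i) *: proj (psi i) = 1%:M]],
      (* 2EPR-GHZ *)
      forall L : 'M[R[i]]_(2 * 2 * (2 * 2)) -> 'M[R[i]]_(2 * 2 * 2),
      EPR2_GHZ_box L ->
      exists (n : nat) (UA UB : 'I_n -> 'M[R[i]]_2)
        (E : 'I_n -> 'M[R[i]]_(2, 2 * 2)),
      [/\ forall i, UA i \is unitarymx,
          forall i, UB i \is unitarymx,
          forall rho, density rho ->
            L rho = kraus_sum (fun i => UA i *t UB i *t E i) rho &
          exists (coef : 'I_n -> R[i]) (c : 'I_2 -> 'cV[R[i]]_2)
            (a b : 'I_n -> 'I_2 -> 'cV[R[i]]_2),
          [/\ forall i, \rank (E i) = 2%N /\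
                E i = coef i *: (ketbra (c 0) (tensv (a i 0) (b i 0)) +
                                 ketbra (c 1) (tensv (a i 1) (b i 1))),
              forall r s, braket (c r) (c s) = (r == s)%:R,
              forall i r s, braket (a i r) (a i s) = (r == s)%:R /\
                            braket (b i r) (b i s) = (r == s)%:R &
              \sum_i `|coef i| ^+ 2 *: (proj (tensv (a i 0) (b i 0)) +
                                        proj (tensv (a i 1) (b i 1))) = 1%:M]] &
      (* GHZ-EPR *)
      forall (c' : nat)
        (L : 'M[R[i]]_(2 * 2 * 2) -> 'M[R[i]]_(2 * 2 * c')),
      GHZ_EPR_box L ->
      exists (n : nat) (UA UB : 'I_n -> 'M[R[i]]_2)
        (E : 'I_n -> 'M[R[i]]_(c', 2)),
      [/\ forall i, UA i \is unitarymx,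
          forall i, UB i \is unitarymx,
          forall rho, density rho ->
            ptrace2 (L rho) =
            ptrace2 (kraus_sum (fun i => UA i *t UB i *t E i) rho) &
          exists (u : 'I_n -> 'cV[R[i]]_c') (psi : 'I_n -> 'cV[R[i]]_2)
            (phi : 'I_n -> R),
          [/\ forall i, \rank (E i) = 1%N /\ E i = ketbra (u i) (psi i),
              forall i, psi i = (sqrtC 2)^-1 *: (ket 0 + cis (phi i) *: ket 1),
              \sum_i (E i)^† *m E i = \sum_i sqnorm (u i) *: proj (psi i) &
              \sum_i sqnorm (u i) *: proj (psi i) = 1%:M]]].
Proof.
split=> [c' L boxL|L boxL|c' L boxL].
- have [n [UA [UB [E [hA hB LE hE]]]]] := ES_box_form boxL.
  by exists n, UA, UB, E; split=> // rho _; rewrite LE.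
- have [n [UA [UB [E [hA hB LE hE]]]]] := EPR2_GHZ_box_form boxL.
  by exists n, UA, UB, E; split=> // rho _; rewrite LE.
- have [n [UA [UB [E [hA hB LE [u [z [z1 hE grE complE]]]]]]]] := GHZ_EPR_box_form boxL.
  have [phi zE] := choice (fun i => cis_surj (z1 i)).
  exists n, UA, UB, E; split=> // [rho _|]; first by rewrite LE.
  exists u, (fun i => (sqrtC 2)^-1 *: (ket 0 + z i *: ket 1)), phi.
  by split=> // i; rewrite zE.
Qed.
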